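(* Let $(W,f)$ be a Latinon. If $t(A,W,f)=\frac{1}{720}$ for every $2\times 3$ pattern $A$, then the Latinon $(W,f)$ is quasirandom, i.e., $t(A,W,f)=\frac{1}{(k\ell)!}$ for all $k,\ell\in\mathbb{N}$ and every $k\times\ell$ pattern $A$.
   Context: Let $\Omega$ denote $[0,1]$ with the uniform (Lebesgue) measure $\lambda$. Let $\mathcal{B}[0,1]$ be the set of Borel probability measures on $[0,1]$ with its natural (weak) topology. A Latinon is a pair $(W,f)$ where $W:\Omega^2\to\mathcal{B}[0,1]$ is measurable, $f:\Omega\to[0,1]$ is measure preserving, and $\int_\Omega W(x,y)(S)\,dy=\int_\Omega W(y,x)(S)\,dy=\lambda(S)$ for almost all $x\in\Omega$ and all Borel $S\subseteq[0,1]$. A $k\times\ell$ pattern is a $k\times\ell$ matrix containing each of $1,\dots,k\ell$ exactly once. The density $t(A,W,f)$ of a $k\times\ell$ pattern $A$ in $(W,f)$ is the probability of the following event: sample $k$ points and $\ell$ points independently uniformly from $\Omega$, name them so that $f(x_1)<\dots<f(x_k)$ and $f(y_1)<\dots<f(y_\ell)$, then independently sample $z_{ab}$ from the measure $W(x_a,y_b)$ for $a\in[k]$, $b\in[\ell]$; the event is that $z_{ab}<z_{a'b'}$ if and only if $A_{ab}<A_{a'b'}$ for all $a,a'\in[k]$, $b,b'\in[\ell]$. The Latinon is quasirandom if $t(A,W,f)=1/(k\ell)!$ for every $k\times\ell$ pattern $A$ and all $k,\ell$. *)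

(* Defs.v *)
From HB Require Import structures.
From mathcomp Require Import all_boot all_order all_algebra all_fingroup.
From mathcomp Require Import all_classical all_reals all_analysis.
From mathcomp Require Import measurable_realfun.

Set Implicit Arguments.
Unset Strict Implicit.
Unset Printing Implicit Defensive.

Import Order.TTheory GRing.Theory Num.Theory.
Import numFieldNormedType.Exports.

Local Open Scope classical_set_scope.
Local Open Scope ring_scope.

Definition unitI (R : realType) : Type := set_type (`[0, 1]%classic : set R).

Section unit_interval.
Variable R : realType.

HB.instance Definition _ := Topological.on (unitI R).

Fact zero_in_unitI : (0 : R) \in (`[0, 1]%classic : set R).
Proof. by rewrite inE /= in_itv /= lexx ler01. Qed.

HB.instance Definition _ :=
  isPointed.Build (unitI R) (exist _ (0 : R) zero_in_unitI).

HB.instance Definition _ :=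
  @isMeasurable.Build default_measure_display (unitI R)
    <<s @open (unitI R) >> (@sigma_algebra0 _ setT open)
    (@sigma_algebraC _ open) (@sigma_algebra_bigcup _ setT open).

Definition valI (x : unitI R) : R := \val x.

Lemma valI_inj : injective valI.
Proof. exact: val_inj. Qed.

Lemma range_valI : range valI = `[0, 1]%classic.
Proof.
apply/seteqP; split => [_ [x _ <-]|x x01]; first exact/set_mem/(valP x).
by exists (exist _ x (mem_set x01)).
Qed.

Lemma measurable_image_valI (A : set (unitI R)) :
  measurable A -> measurable (valI @` A : set (measurableTypeR R)).
Proof.
have m01 : measurable (range valI : set (measurableTypeR R)).
  by rewrite range_valI.
move=> mA.
apply: (mA [set B | measurable (valI @` B : set (measurableTypeR R))]).
split; first split => [|B mB|F mF].
- by rewrite /= image_set0.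
- rewrite /= (_ : valI @` (setT `\` B) = range valI `\` (valI @` B)).
    exact: measurableD.
  apply/seteqP; split => [_ [x [_ nBx] <-]|_ [[x _ <-] nBx]].
    by split; [exists x|move=> [y By /valI_inj yx]; apply: nBx; rewrite -yx].
  by exists x => //; split => // Bx; apply: nBx; exists x.
- by rewrite /= image_bigcup; apply: bigcupT_measurable.
- move=> B [U oU <-] /=.
  rewrite (_ : valI @` _ = U `&` range valI).
    by apply: measurableI => //; exact: open_measurable.
  apply/seteqP; split => [_ [x Ux <-]|y [Uy [x _ xE]]].
    by split => //; exists x.
  by rewrite -xE in Uy *; exists x.
Qed.

(* Lebesgue measure on the Borel subsets of [0, 1]. *)
Definition lebI (A : set (unitI R)) : \bar R :=
  @lebesgue_measure R (valI @` A).

Fact lebI0 : lebI set0 = 0%E.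
Proof. by rewrite /lebI image_set0 measure0. Qed.

Fact lebI_ge0 A : (0 <= lebI A)%E.
Proof. exact: measure_ge0. Qed.

Fact lebI_sigma_additive : semi_sigma_additive lebI.
Proof.
move=> F mF tF mUF; rewrite /lebI image_bigcup.
apply: measure_semi_sigma_additive.
- by move=> n; exact: measurable_image_valI.
- move=> i j _ _ [_ [[x Fx <-] [y Fy /valI_inj yx]]]; apply: tF => //.
  by exists x; split => //; rewrite -yx.
- by rewrite -image_bigcup; exact: measurable_image_valI.
Qed.

HB.instance Definition _ := isMeasure.Build _ _ _ lebI
  lebI0 lebI_ge0 lebI_sigma_additive.

Fact lebI_setT : lebI setT = 1%E.
Proof.
rewrite /lebI range_valI.
by rewrite lebesgue_measure_itv /= lte_fin ltr01 oppr0 adde0.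
Qed.

HB.instance Definition _ := Measure_isProbability.Build _ _ _ lebI lebI_setT.

(* The weak topology is the coarsest one for which mu |-> \int g dmu is
   continuous for every continuous g : [0, 1] -> R. *)
Definition weakP : Type := initial_topology
  (fun (mu : probability (unitI R) R) =>
    (fun g : continuousType (unitI R) R => \int[mu]_x g x)
      : {ptws continuousType (unitI R) R -> R}).

HB.instance Definition _ := Topological.on weakP.
HB.instance Definition _ := Pointed.copy weakP (probability (unitI R) R).

HB.instance Definition _ :=
  @isMeasurable.Build default_measure_display weakP
    <<s @open weakP >> (@sigma_algebra0 _ setT open)
    (@sigma_algebraC _ open) (@sigma_algebra_bigcup _ setT open).

End unit_interval.
Arguments lebI {R}.

Section finite_product.
Context d (T : measurableType d) (R : realType).

Definition cons_pair n (p : T * n.-tuple T) : n.+1.-tuple T :=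
  [tuple of p.1 :: p.2].

Fact measurable_cons_pair n : measurable_fun setT (@cons_pair n).
Proof. exact: measurable_cons. Qed.

HB.instance Definition _ n :=
  isMeasurableFun.Build _ _ _ _ (@cons_pair n) (@measurable_cons_pair n).

(* The product of n probability measures, i.e. the joint law of independent
   samples drawn from P 0, ..., P (n - 1). *)
Fixpoint prodP n : ('I_n -> probability T R) -> probability (n.-tuple T) R :=
  match n with
  | 0 => fun=> \d_([tuple])
  | m.+1 => fun P =>
      distribution (P ord0 \x prodP (fun i => P (lift ord0 i)))%E (@cons_pair m)
  end.

End finite_product.

Section latinon.
Variable R : realType.
Local Notation Omega := (unitI R).

Definition measure_preserving (f : Omega -> Omega) : Prop :=
  measurable_fun setT f /\
  forall S, measurable S -> lebI (f @^-1` S) = lebI S.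

Definition latinon (W : Omega * Omega -> probability Omega R)
    (f : Omega -> Omega) : Prop :=
  [/\ measurable_fun setT (W : Omega * Omega -> weakP R),
      measure_preserving f &
      {ae lebI, forall x, forall S, measurable S ->
        (\int[lebI]_y W (x, y) S = lebI S)%E /\
        (\int[lebI]_y W (y, x) S = lebI S)%E}].

Definition pattern k l (A : 'M[nat]_(k, l)) : Prop :=
  forall m, (1 <= m <= k * l)%N ->
    exists! ab : 'I_k * 'I_l, A ab.1 ab.2 = m.

Definition increasing n (u : 'I_n -> Omega) : bool :=
  [forall i : 'I_n, forall j : 'I_n, (i < j)%N ==> (valI (u i) < valI (u j))].

(* z is the tuple of the k rows of the sampled matrix. *)
Definition pattern_event k l (A : 'M[nat]_(k, l)) :
    set (k.-tuple (l.-tuple Omega)) :=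
  [set z | forall a a' b b',
    valI (tnth (tnth z a) b) < valI (tnth (tnth z a') b') <->
    (A a b < A a' b')%N].

(* The permutations s and t rename the sampled points so that their f-values
   increase.  If the f-values of x (or of y) are not pairwise distinct, which
   has probability 0, the sum is empty; otherwise it has exactly one term. *)
Definition density (W : Omega * Omega -> probability Omega R)
    (f : Omega -> Omega) k l (A : 'M[nat]_(k, l)) : \bar R :=
  (\int[prodP (fun _ : 'I_k => lebI)]_x \int[prodP (fun _ : 'I_l => lebI)]_y
    \sum_(s : 'S_k | increasing (fun a => f (tnth x (s a))))
    \sum_(t : 'S_l | increasing (fun b => f (tnth y (t b))))
      prodP (fun a => prodP (fun b => W (tnth x (s a), tnth y (t b))))
        (pattern_event A))%E.

Definition quasirandom (W : Omega * Omega -> probability Omega R)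
    (f : Omega -> Omega) : Prop :=
  forall k l (A : 'M[nat]_(k, l)), pattern A ->
    density W f A = (((k * l)`!%:R)^-1)%:E.

End latinon.

(* Main.v *)
Require Import Defs.
From HB Require Import structures.
From mathcomp Require Import all_boot all_order all_algebra all_fingroup.
From mathcomp Require Import all_classical all_reals all_analysis.
From mathcomp Require Import measurable_realfun ring.

(** Write [U_z(x, y)] for [W(x, y)([0, z))] and [G_z(x, x')] for the integral over [y] of
    [U_z(x, y) U_z(x', y)].  If all 2 x 3 patterns are equally likely, then so are all
    relative orders of the six sampled entries, so a fixed entry exceeds four other given
    ones at most as often as for i.i.d. uniform entries.  Apply this to the entry in the
    first row and first column against the 2 x 2 block in the other two columns: averaged
    over its column, the former is uniform and independent of that block, so the integral
    over [z] of the 4-cycle density of [U_z], that is of [G_z ^ 2], is at most that of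
    [z ^ 4].  Since [U_z] is regular of degree [z], the mean of [G_z] is [z ^ 2], so for
    almost every [z] the variance of [G_z] vanishes.  Constant codegrees force
    [U_z = z] almost everywhere, hence almost every [W(x, y)] is the uniform measure. *)

Set Implicit Arguments.
Unset Strict Implicit.
Unset Printing Implicit Defensive.

Import Order.TTheory GRing.Theory Num.Theory.
Import numFieldNormedType.Exports.

Local Open Scope classical_set_scope.
Local Open Scope ring_scope.

(** * Product measures on tuples *)

Section box.
Context d (T : measurableType d).

(** A density names the sampled points by their [f]-values, whereas the argument needs the entries
    in the order of sampling. Summing the densities of all patterns obtained from one by permuting
    rows and columns removes [f]: at almost all points the sum runs over every renaming once, and
    exchangeability gives all renamings the same average. The threshold entry needs a column of its
    own: averaging over that column must leave the 2 x 2 block untouched. One inequality is enough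
    because the mean square of [G_z] is at least the square of its mean, [z ^ 4], for every [z]; an
    upper bound on the integral over [z] then leaves no slack for almost every [z]. Why constant
    codegrees suffice: for a set [A] of rows, the weight of column [y] in [A] has mean [z * lam A]
    by the row degrees and mean square [(z * lam A) ^ 2] by the codegrees, hence is almost
    everywhere constant. So [U_z] and the constant [z] have the same integral over every rectangle.
    The null sets depend on [z]; Fubini exchanges the quantifiers, and monotonicity of distribution
    functions repairs the exceptional [z]. *)

Definition box n (B : 'I_n -> set T) : set (n.-tuple T) :=
  [set u | forall i, B i (tnth u i)].

Definition boxes n : set (set (n.-tuple T)) :=
  [set X | exists2 B, (forall i, measurable (B i)) & X = @box n B].
#[local] Arguments boxes n : clear implicits.

Lemma measurable_box n (B : 'I_n -> set T) :
  (forall i, measurable (B i)) -> measurable (box B).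
Proof.
move=> mB; rewrite (_ : box B = \bigcap_(i in [set: 'I_n]) ((@tnth _ T)^~ i @^-1` B i)).
  apply: fin_bigcap_measurable => // i _.
  by rewrite -[X in measurable X]setTI; exact: measurable_tnth.
by apply/seteqP; split => [u uB i _|u uB i]; [exact: uB|exact: (uB i I)].
Qed.

Lemma setI_closed_boxes n : setI_closed (boxes n).
Proof.
move=> _ _ [A mA ->] [B mB ->]; exists (fun i => A i `&` B i).
  by move=> i; exact: measurableI.
apply/seteqP; split => [u [uA uB] i|u uAB]; first by split; [exact: uA|exact: uB].
by split => i; have [] := uAB i.
Qed.

(** Unlike the one-coordinate cylinders, boxes are closed under intersection, so a probability on
    tuples is determined by its values on boxes. *)
Lemma measurable_tupleE n : @measurable _ (n.-tuple T) = <<s boxes n >>.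
Proof.
apply/seteqP; split; last first.
  apply: smallest_sub; first exact: sigma_algebra_measurable.
  by move=> _ [B mB ->]; exact: measurable_box.
apply: smallest_sub; first exact: smallest_sigma_algebra.
elim/big_ind : _ => // [A B hA hB|i _]; first by rewrite subUset.
move=> _ [B mB <-]; rewrite setTI; apply: sub_sigma_algebra.
exists (fun j => if j == i then B else setT).
  by move=> j; case: ifP.
apply/seteqP; split => [u uB j|u /(_ i)]; last by rewrite eqxx.
by case: ifPn => // /eqP ->.
Qed.

Lemma boxesT n : boxes n setT.
Proof.
by exists (fun=> setT) => //; apply/seteqP; split.
Qed.

End box.
#[local] Arguments boxes {d} T n.

Section prodP.
Context d (T : measurableType d) (R : realType).

Lemma prodP_box n (P : 'I_n -> probability T R) (B : 'I_n -> set T) :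
  (forall i, measurable (B i)) ->
  prodP P (box B) = (\prod_(i < n) fine (P i (B i)))%:E.
Proof.
elim: n P B => [|n IH] P B mB.
  rewrite big_ord0 /= diracE mem_set//.
  by case.
rewrite big_ord_recl EFinM fineK ?fin_num_measure//.
rewrite -(IH (fun i => P (lift ord0 i)) (fun i => B (lift ord0 i)))//.
rewrite -product_measure1E//; last exact: measurable_box.
rewrite /= /distribution /pushforward; congr (_ _).
apply/seteqP; split => [[x u] /= xuB|[x u] /= [xB uB] i].
  by split => [|i]; [exact: (xuB ord0)|have := xuB (lift ord0 i); rewrite tnthS].
by case: (unliftP ord0 i) => [j ->|->]; rewrite ?tnthS.
Qed.

Lemma box_probability_unique n (m1 m2 : probability (n.-tuple T) R) :
  (forall B, (forall i, measurable (B i)) -> m1 (box B) = m2 (box B)) ->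
  forall A, measurable A -> m1 A = m2 A.
Proof.
move=> m12 A mA.
apply: (measure_unique (boxes T n) (fun=> setT)) => //.
- exact: measurable_tupleE.
- exact: setI_closed_boxes.
- by move=> _; exact: boxesT.
- by rewrite bigcup_const//; exists 0%N.
- by move=> _ [B mB ->]; exact: m12.
- by move=> _; rewrite (le_lt_trans (probability_le1 m1 measurableT)) ?ltry.
Qed.

Lemma eq_prodP n (P Q : 'I_n -> probability T R) :
  (forall i S, measurable S -> P i S = Q i S) ->
  forall A, measurable A -> prodP P A = prodP Q A.
Proof.
move=> PQ; apply: box_probability_unique => B mB.
rewrite !prodP_box//; congr EFin; apply: eq_bigr => i _; by rewrite PQ.
Qed.

Definition reindex_tuple n m (g : 'I_m -> 'I_n) (u : n.-tuple T) : m.-tuple T :=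
  [tuple tnth u (g i) | i < m].

Lemma measurable_reindex_tuple n m (g : 'I_m -> 'I_n) :
  measurable_fun setT (reindex_tuple g).
Proof.
apply/measurable_fun_tnthP => i.
rewrite (_ : _ \o _ = (@tnth _ T)^~ (g i)); first exact: measurable_tnth.
by apply/funext => u /=; rewrite tnth_mktuple.
Qed.

HB.instance Definition _ n m (g : 'I_m -> 'I_n) :=
  isMeasurableFun.Build _ _ _ _ (reindex_tuple g) (measurable_reindex_tuple g).

(** Injectivity of [g] keeps the selected coordinates independent. Used both for permuting samples
    and for extracting one or two of them. *)
Lemma prodP_reindex n m (g : 'I_m -> 'I_n) (P : 'I_n -> probability T R) A :
  injective g -> measurable A ->
  prodP P (reindex_tuple g @^-1` A) = prodP (P \o g) A.
Proof.
move=> gI; apply: (@box_probability_unique _ (distribution (prodP P) (reindex_tuple g))).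
move=> B mB; rewrite [RHS]prodP_box// -[LHS]/(prodP P (reindex_tuple g @^-1` box B)).
(* Pull the box back to all [n] coordinates: the constraint on [g i] is [B i], and coordinates
   outside the image of [g] contribute a factor 1. *)
pose C j := if [pick i | g i == j] is Some i then B i else setT.
have Cg i : C (g i) = B i.
  rewrite /C; case: pickP => [i' /eqP/gI -> //|/(_ i)]; by rewrite eqxx.
rewrite (_ : reindex_tuple g @^-1` _ = box C).
  rewrite prodP_box; last by move=> j; rewrite /C; case: pickP.
  congr EFin; rewrite (bigID [pred j | j \in codom g])/= [X in _ * X]big1 ?mulr1.
    rewrite -big_uniq /=; last exact/injectiveP.
    by rewrite big_map big_enum; apply: eq_bigr => i _; rewrite Cg.
  move=> j jg; rewrite /C; case: pickP => [i /eqP gij|]; last by rewrite probability_setT.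
  by rewrite -gij codom_f in jg.
apply/seteqP; split => [u /= uB j|u uC i].
  by rewrite /C; case: pickP => // i /eqP <-; have := uB i; rewrite tnth_mktuple.
by rewrite tnth_mktuple -Cg.
Qed.

End prodP.

Section flatten.
Context d (T : measurableType d) (R : realType).

Definition flatten_tuple k l m (e : 'I_m -> 'I_k * 'I_l) (z : k.-tuple (l.-tuple T))
  : m.-tuple T := [tuple tnth (tnth z (e i).1) (e i).2 | i < m].

Lemma measurable_flatten_tuple k l m (e : 'I_m -> 'I_k * 'I_l) :
  measurable_fun setT (flatten_tuple e).
Proof.
apply/measurable_fun_tnthP => i.
rewrite (_ : _ \o _ = (@tnth _ T)^~ (e i).2 \o (@tnth _ (l.-tuple T))^~ (e i).1).
  by apply: measurableT_comp; exact: measurable_tnth.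
by apply/funext => u /=; rewrite tnth_mktuple.
Qed.

HB.instance Definition _ k l m (e : 'I_m -> 'I_k * 'I_l) :=
  isMeasurableFun.Build _ _ _ _ (flatten_tuple e) (measurable_flatten_tuple e).

(** [density] samples the matrix row by row; this reads the same entries as one independent list in
    an arbitrary order of the cells. *)
Lemma prodP_flatten k l m (e : 'I_m -> 'I_k * 'I_l)
    (P : 'I_k * 'I_l -> probability T R) A :
  injective e -> measurable A ->
  prodP (fun a => prodP (fun b => P (a, b))) (flatten_tuple e @^-1` A) =
  prodP (P \o e) A.
Proof.
move=> eI; apply: (@box_probability_unique _ _ _ _
  (distribution (prodP (fun a => prodP (fun b => P (a, b)))) (flatten_tuple e))).
move=> B mB; rewrite [RHS]prodP_box//.
rewrite -[LHS]/(prodP (fun a => prodP (fun b => P (a, b))) (flatten_tuple e @^-1` box B)).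
pose C j := if [pick i | e i == j] is Some i then B i else setT.
have Ce i : C (e i) = B i.
  rewrite /C; case: pickP => [i' /eqP/eI -> //|/(_ i)]; by rewrite eqxx.
have mC j : measurable (C j) by rewrite /C; case: pickP.
rewrite (_ : flatten_tuple e @^-1` _ = box (fun a => box (fun b => C (a, b)))).
  rewrite prodP_box; last by move=> a; exact: measurable_box.
  under eq_bigr do rewrite prodP_box//=.
  congr EFin; rewrite pair_big /=.
  under eq_bigr do rewrite -surjective_pairing.
  rewrite (bigID [pred j | j \in codom e])/= [X in _ * X]big1 ?mulr1.
    rewrite -big_uniq /=; last exact/injectiveP.
    by rewrite big_map big_enum; apply: eq_bigr => i _; rewrite Ce.
  move=> j je; rewrite /C; case: pickP => [i /eqP eij|]; last by rewrite probability_setT.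
  by rewrite -eij codom_f in je.
apply/seteqP; split => [u /= uB a b|u uC i].
  rewrite /C; case: pickP => // i /eqP eiab.
  by have := uB i; rewrite tnth_mktuple eiab.
by rewrite tnth_mktuple -Ce; have := uC (e i).1 (e i).2; rewrite -surjective_pairing.
Qed.

End flatten.

(** * Measurable families of probability measures *)

Section kernel.
Context d' (X : measurableType d') (R : realType).
Local Open Scope ereal_scope.

Definition is_kernel d (T : measurableType d) (P : X -> probability T R) :=
  forall A, measurable A -> measurable_fun setT (fun x => P x A).

(** The sets whose mass depends measurably on the parameter form a Dynkin system, so an
    intersection-stable generating family suffices. *)
Lemma is_kernel_generated d (T : measurableType d) (G : set (set T))
    (P : X -> probability T R) :
  @measurable _ T = <<s G >> -> setI_closed G ->
  (forall A, G A -> measurable_fun setT (fun x => P x A)) -> is_kernel P.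
Proof.
move=> mG GI GP A mA; have: <<s G >> A by rewrite -mG.
move: A {mA}; apply: (dynkin_induction mG GI) => //.
- by under eq_fun do rewrite probability_setT; exact: measurable_cst.
- move=> S mS PS.
  under eq_fun do rewrite probability_setC//.
  by apply: emeasurable_funB.
- move=> F mF tF PF.
  rewrite (_ : (fun _ => _) = fun x => \sum_(0 <= k <oo) P x (F k)); last first.
    by apply/funext => x; rewrite measure_semi_bigcup//; exact: bigcup_measurable.
  by apply: ge0_emeasurable_sum.
Qed.

Lemma is_kernel_prodP d (T : measurableType d) n
    (P : 'I_n -> X -> probability T R) :
  (forall i, is_kernel (P i)) -> is_kernel (fun x => prodP (P ^~ x)).
Proof.
move=> kP; apply: (@is_kernel_generated _ _ (boxes T n)).
- exact: measurable_tupleE.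
- exact: setI_closed_boxes.
- move=> _ [B mB ->]; under eq_fun do rewrite prodP_box//.
  apply/measurable_EFinP; apply: measurable_prod => i _.
  by apply: measurableT_comp => //; exact: kP.
Qed.

Lemma is_kernel_comp d (T : measurableType d) d2 (Y : measurableType d2)
    (g : X -> Y) (P : Y -> probability T R) :
  measurable_fun setT g ->
  (forall A, measurable A -> measurable_fun setT (fun x => P x A)) ->
  is_kernel (fun x => P (g x)).
Proof. by move=> mg kP A mA; apply: measurableT_comp (kP A mA) _. Qed.

End kernel.

(** * The unit interval *)

Section integral_bound.
Context d (T : measurableType d) (R : realType) (mu : probability T R).
Local Open Scope ereal_scope.

Lemma integral_probability_le (f : T -> \bar R) (c : R) :
  measurable_fun setT f -> (forall x, 0 <= f x) -> (forall x, f x <= c%:E) ->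
  \int[mu]_x f x <= c%:E.
Proof.
move=> mf f0 fc; rewrite -[leRHS]mule1 -(@probability_setT _ _ _ mu) -integral_cst//.
by apply: ge0_le_integral => // x _; exact: le_trans (fc x).
Qed.

Lemma integral_probability_fin_num (f : T -> \bar R) (c : R) :
  measurable_fun setT f -> (forall x, 0 <= f x) -> (forall x, f x <= c%:E) ->
  \int[mu]_x f x \is a fin_num.
Proof.
move=> mf f0 fc; rewrite ge0_fin_numE; last exact: integral_ge0.
by rewrite (le_lt_trans (integral_probability_le mf f0 fc))// ltry.
Qed.

Lemma integral_probability_cst (c : R) : \int[mu]_x c%:E = c%:E.
Proof. by rewrite -[RHS]mule1 -(@probability_setT _ _ _ mu); exact: integral_cst. Qed.

End integral_bound.

Section comparison_sets.
Context d (T : measurableType d) (R : realType) (f g : T -> R).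
Hypotheses (mf : measurable_fun setT f) (mg : measurable_fun setT g).

Lemma measurable_ltr_set : measurable [set x | f x < g x].
Proof.
rewrite (_ : [set x | _] = setT `&` (fun x => f x < g x) @^-1` [set true]).
  exact: measurable_fun_ltr.
by rewrite setTI; apply/seteqP; split.
Qed.

Lemma measurable_eqr_set : measurable [set x | f x = g x].
Proof.
rewrite (_ : [set x | _] = setT `&` (fun x => f x == g x) @^-1` [set true]).
  exact: measurable_fun_eqr.
by rewrite setTI; apply/seteqP; split => x /= /eqP.
Qed.

End comparison_sets.

Section unit_interval.
Variable R : realType.
Local Notation Omega := (unitI R).

Lemma continuous_valI : continuous (@valI R).
Proof. exact: initial_continuous. Qed.

Lemma measurable_valI : measurable_fun setT (@valI R).
Proof.
apply: (measurability _ (RGenOpens.measurableE R)) => _ [_ [a [b ->]] <-].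
rewrite setTI; apply: sub_sigma_algebra.
by exists `]a, b[%classic => //; exact: interval_open.
Qed.

Definition rays : set (set Omega) :=
  [set X | exists c, X = [set x | valI x < c]].

Lemma measurable_ray c : measurable [set x : Omega | valI x < c].
Proof.
rewrite -[X in measurable X]setTI.
have := measurable_valI measurableT (measurable_itv `]-oo, c[).
by rewrite (_ : _ @^-1` _ = [set x | valI x < c]) //; apply/seteqP; split => x /=;
  rewrite in_itv.
Qed.

Lemma setI_closed_rays : setI_closed rays.
Proof.
move=> _ _ [c ->] [d ->]; exists (Num.min c d).
by apply/seteqP; split => x /=; rewrite lt_min => /andP.
Qed.

(** The Borel sets of the subspace are the traces of those of the line, which open half-lines
    generate. *)
Lemma measurable_unitIE : @measurable _ Omega = <<s rays >>.
Proof.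
apply/seteqP; split; last first.
  apply: smallest_sub; first exact: sigma_algebra_measurable.
  by move=> _ [c ->]; exact: measurable_ray.
apply: smallest_sub; first exact: smallest_sigma_algebra.
move=> _ [U oU <-].
have mU : measurable (U : set (measurableTypeR R)) by exact: open_measurable.
have: (@RGenInftyO.G R).-sigma.-measurable U by rewrite -RGenInftyO.measurableE.
move=> mU'.
have: preimage_set_system setT (@valI R) (@RGenInftyO.G R).-sigma.-measurable (@valI R
  @^-1` U).
  by exists U => //; rewrite setTI.
rewrite -g_sigma_preimageE; apply: smallest_sub; first exact: smallest_sigma_algebra.
move=> _ [_ [c ->] <-]; rewrite setTI; apply: sub_sigma_algebra; exists c.
by apply/seteqP; split => x /=; rewrite in_itv.
Qed.

Lemma unitI_probability_unique (m1 m2 : probability Omega R) :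
  (forall c, m1 [set x | valI x < c] = m2 [set x | valI x < c]) ->
  forall A, measurable A -> m1 A = m2 A.
Proof.
move=> m12 A mA.
apply: (measure_unique rays (fun=> setT)) => //.
- exact: measurable_unitIE.
- exact: setI_closed_rays.
(* Thresholds range over all reals, so any bound above 1 shows that the whole space is a ray. *)
- move=> _; exists 2; apply/seteqP; split => // x _ /=.
  have : `[0, 1]%classic (valI x) by rewrite -range_valI; exists x.
  by rewrite /= in_itv/= => /andP[_ /le_lt_trans]; apply; rewrite ltr1n.
- by rewrite bigcup_const//; exists 0%N.
- by move=> _ [c ->]; exact: m12.
- by move=> _; rewrite (le_lt_trans (probability_le1 m1 measurableT)) ?ltry.
Qed.

(* The weak topology only gives access to integrals of continuous functions;
   [ramp c n] increases with [n] to the indicator of [valI x < c]. *)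
Definition ramp (c : R) (n : nat) (x : Omega) : R :=
  Num.min 1 (n%:R * Num.max 0 (c - valI x)).

Lemma continuous_ramp c n : continuous (ramp c n).
Proof.
move=> x; apply: (@continuous_min R _ (cst 1)
  (fun x => n%:R * Num.max 0 (c - valI x)) x); first exact: cst_continuous.
apply: (@continuousM R _ (cst n%:R) (fun x => Num.max 0 (c - valI x)) x).
  exact: cst_continuous.
apply: (@continuous_max R _ (cst 0) (fun x => c - valI x) x); first exact: cst_continuous.
by apply: (@continuousB _ R^o _ (cst c)); [exact: cst_continuous|exact: continuous_valI].
Qed.

Lemma ramp_ge0 c n x : 0 <= ramp c n x.
Proof. by rewrite /ramp le_min ler01/= mulr_ge0// le_max lexx. Qed.

Lemma ramp_le1 c n x : ramp c n x <= 1.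
Proof. by rewrite /ramp ge_min lexx. Qed.

Lemma measurable_ramp c n : measurable_fun setT (ramp c n).
Proof.
apply: measurable_minr; first exact: measurable_cst.
apply: measurable_funM; first exact: measurable_cst.
apply: measurable_maxr; first exact: measurable_cst.
by apply: measurable_funB; [exact: measurable_cst|exact: measurable_valI].
Qed.

Lemma integral_ramp_cvg (mu : probability Omega R) c :
  (\int[mu]_x (ramp c n x)%:E @[n --> \oo] --> mu [set x | (valI x < c)%R])%E.
Proof.
have -> : mu [set x | valI x < c] = (\int[mu]_x (\1_[set x | (valI x < c)%R] x)%:E)%E.
  by rewrite integral_indic// ?setIT//; exact: measurable_ray.
rewrite (_ : (fun x => _) = (fun x => limn (fun n => (ramp c n x)%:E))); last first.
  apply/funext => x; apply/esym/cvg_lim => //; rewrite indicE.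
  case: (ltP (valI x) c) => xc; last first.
    rewrite memNset; last by move=> /=; rewrite ltNge xc.
    apply: cvg_near_cst; apply: nearW => n.
    by rewrite /ramp max_l ?subr_le0// mulr0 min_r.
  (* The ramp equals 1 as soon as [n] is at least the inverse of [c - valI x]. *)
  rewrite mem_set//; apply: cvg_near_cst; near=> n.
  rewrite /ramp max_r ?subr_ge0 1?ltW// min_l//.
  rewrite -ler_pdivrMr ?subr_gt0// mul1r.
  by near: n; exact: nbhs_infty_ger.
apply: cvg_monotone_convergence => //.
- by move=> n; apply/measurable_EFinP; exact: measurable_ramp.
- by move=> n x _; rewrite lee_fin ramp_ge0.
- move=> x _ m n mn; rewrite lee_fin /ramp le_min ge_min lexx/= ge_min.
  by rewrite ler_wpM2r ?orbT// ?le_max ?lexx// ler_nat.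
Unshelve. all: by end_near. Qed.

Lemma measurable_integral_ramp c n :
  measurable_fun setT (fun mu : weakP R => (\int[mu : probability Omega R]_x (ramp c n
    x)%:E)%E).
Proof.
(* Integration against a fixed continuous function is the map defining the weak topology followed by
   an evaluation. *)
have cf : continuous (fun mu : weakP R => \int[mu : probability Omega R]_x (mkcts
  (@continuous_ramp c n) x)).
  set F := (fun (mu : probability (unitI R) R) =>
    (fun g : continuousType (unitI R) R => \int[mu]_x g x)
      : {ptws continuousType (unitI R) R -> R}).
  move=> mu; apply: (@continuous_comp _ _ _ (F : weakP R -> _)
    (@proj _ (fun=> R) (mkcts (@continuous_ramp c n) : continuousType _ _))).
    exact: initial_continuous.
  exact: proj_continuous.
have mf : measurable_fun setT (fun mu : weakP R =>
  \int[mu : probability Omega R]_x (mkcts (@continuous_ramp c n) x)).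
  apply: (measurability _ (RGenOpens.measurableE R)) => _ [_ [a [b ->]] <-].
  rewrite setTI; apply: sub_sigma_algebra.
  by move/continuousP : cf; apply; exact: interval_open.
rewrite (_ : (fun mu => _) = (fun mu : weakP R =>
  (\int[mu : probability Omega R]_x (mkcts (@continuous_ramp c n) x))%:E)).
  exact/measurable_EFinP.
apply/funext => mu; rewrite /Rintegral fineK//.
apply: (@integral_probability_fin_num _ _ _ _ _ 1).
- by apply/measurable_EFinP; exact: measurable_ramp.
- by move=> x; rewrite lee_fin ramp_ge0.
- by move=> x; rewrite lee_fin ramp_le1.
Qed.

(** The mass of a ray is the limit of the integrals of continuous ramps, each of which is measurable
    for the weak topology; rays generate the Borel sets. *)
Lemma weakP_kernel d (X : measurableType d) (W : X -> probability Omega R) :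
  measurable_fun setT (W : X -> weakP R) -> is_kernel W.
Proof.
move=> mW; apply: (@is_kernel_generated _ X R _ Omega rays W measurable_unitIE
  setI_closed_rays).
move=> _ [c ->].
apply: (@emeasurable_fun_cvg _ _ _ _ (fun n x => \int[W x]_y (ramp c n y)%:E)%E).
  by move=> n; apply: measurableT_comp (measurable_integral_ramp c n) mW.
by move=> x _; exact: integral_ramp_cvg.
Qed.

End unit_interval.

(** * Sorting independent samples *)

Section rank.
Variables (R : realType) (n : nat) (u : 'I_n -> R).
Hypothesis u_inj : injective u.

Let rank (i : 'I_n) : nat := #|[set j | u j < u i]|%SET.

Let rank_lt i j : u i < u j -> (rank i < rank j)%N.
Proof.
move=> uij; apply: proper_card; apply/properP; split.
  by apply/fintype.subsetP => k; rewrite !finset.inE => /lt_trans; exact.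
by exists i; rewrite !finset.inE ?ltxx.
Qed.

Let rank_bound i : (rank i < n)%N.
Proof.
rewrite -[X in (_ < X)%N]card_ord -cardsT; apply: proper_card; apply/properP; split.
  exact: finset.subsetT.
by exists i; rewrite !finset.inE ?ltxx.
Qed.

Let rank_ord i := Ordinal (rank_bound i).

Let rank_ord_inj : injective rank_ord.
Proof.
move=> i j /(congr1 val)/= ij; apply: u_inj; apply/eqP; rewrite eq_le !leNgt.
by apply/andP; split; apply/negP => /rank_lt; rewrite ij ltnn.
Qed.

(** The sorting permutation is the inverse of the rank function, which is a permutation because the
    values are distinct. *)
Lemma exists_unique_sort : exists s : 'S_n, forall t : 'S_n,
  [forall i : 'I_n, forall j : 'I_n, (i < j)%N ==> (u (t i) < u (t j))] = (t == s).
Proof.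
pose r := perm rank_ord_inj; exists (r^-1)%g => t; apply/idP/idP; last first.
  move=> /eqP ->; apply/forallP => i; apply/forallP => j; apply/implyP => ij.
  rewrite ltNge le_eqVlt; apply/negP => /orP[/eqP/u_inj/perm_inj ji|/rank_lt].
    by rewrite ji ltnn in ij.
  have rk k : rank ((r^-1)%g k) = k.
    by have := congr1 val (permKV r k); rewrite {1}/r permE.
  by rewrite !rk ltnNge ltnW.
move=> /forallP tinc; apply/eqP/permP => i; apply: (@perm_inj _ r).
rewrite permKV permE; apply: val_inj => /=; rewrite /rank.
have tlt a b : (u (t a) < u (t b)) = (a < b)%N.
  case: (ltngtP a b) => [ab|ba|/val_inj ->]; last by rewrite ltxx.
    by have /forallP/(_ b)/implyP/(_ ab) := tinc a.
  by apply/negbTE; rewrite -leNgt ltW//; have /forallP/(_ a)/implyP/(_ ba) := tinc b.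
(* If [t] sorts, its inverse maps the indices with value below [u (t i)] onto the indices below [i],
   so [t i] has rank [i]. *)
rewrite -(card_imset _ (@perm_inj _ t^-1)%g).
rewrite (_ : imset _ _ = [set j : 'I_n | (j < i)%N]%SET).
  have -> : [set j : 'I_n | (j < i)%N]%SET = [set widen_ord (ltnW (ltn_ord i)) j | j in
    'I_i]%SET.
    apply/setP => j; rewrite finset.inE; apply/idP/imsetP => [ji|[k _ ->]];
      last exact: ltn_ord k.
    by exists (Ordinal ji) => //; exact: val_inj.
  rewrite card_imset ?card_ord// => a b /(congr1 val)/= ab; exact: val_inj.
apply/setP => j; rewrite finset.inE; apply/imsetP/idP => [[k]|ji].
  by rewrite finset.inE => + ->; rewrite -[X in u X < _](permKV t) tlt.
by exists (t j); rewrite ?permK// finset.inE tlt.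
Qed.

End rank.

Section marginals.
Context d (T : measurableType d) (R : realType).
Local Open Scope ereal_scope.

Lemma prodP_tnth n (P : 'I_n -> probability T R) i A : measurable A ->
  prodP P [set u | A (tnth u i)] = P i A.
Proof.
move=> mA; have := @prodP_reindex _ _ R n 1 (fun=> i) P (box (fun=> A)).
rewrite prodP_box//= big_ord1 fineK ?fin_num_measure// => <-//.
- congr (prodP P _); apply/seteqP; split => [u uA j|u /(_ ord0)].
    by rewrite tnth_mktuple.
  by rewrite tnth_mktuple.
- by move=> a b _; rewrite !ord1.
- exact: measurable_box.
Qed.

Lemma prodP_pair n (P : 'I_n -> probability T R) i j A : i != j -> measurable A ->
  prodP P [set u | A (tnth u i, tnth u j)] = (P i \x P j) A.
Proof.
move=> ij mA.
have mX : measurable_fun setT (fun u : n.-tuple T => (tnth u i, tnth u j)).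
  by apply: measurable_fun_pair; exact: measurable_tnth.
pose X : {mfun (n.-tuple T) >-> (T * T)%type} :=
  HB.pack (fun u : n.-tuple T => (tnth u i, tnth u j))
    (isMeasurableFun.Build _ _ _ _ _ mX).
apply/esym; apply: (@product_measure_unique _ _ _ _ _ (P i) (P j)
  (distribution (prodP P) X)) => // B C mB mC.
pose g (a : 'I_2) := if a == ord0 then i else j.
have := @prodP_reindex _ _ R n 2 g P (box (fun a => if a == ord0 then B else C)).
rewrite prodP_box//=; last by move=> a; case: ifP.
rewrite !big_ord_recl big_ord0 mulr1 EFinM /g/= !fineK ?fin_num_measure// => <-.
- rewrite -[LHS]/(prodP P _); congr (prodP P _).
  apply/seteqP; split => [u [uB uC] a|u /= uBC].
    by rewrite tnth_mktuple; case: ifP.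
  by split; [have := uBC ord0|have := uBC ord_max]; rewrite tnth_mktuple.
- move=> a b; case: eqVneq => [->|a0]; case: eqVneq => [->//|b0] /eqP.
  + by rewrite (negbTE ij).
  + by rewrite eq_sym (negbTE ij).
  + move=> _; apply: val_inj; move: a b a0 b0 => [[|[|]]//= ?] [[|[|]]//=].
- by apply: measurable_box => a; case: ifP.
Qed.

Lemma prodP_cross k l (P : 'I_k -> probability T R) (Q : 'I_l -> probability T R)
    i j A : measurable A ->
  (prodP P \x prodP Q) [set u | A (tnth u.1 i, tnth u.2 j)] = (P i \x Q j) A.
Proof.
move=> mA.
have mX : measurable_fun setT (fun u : k.-tuple T * l.-tuple T =>
  (tnth u.1 i, tnth u.2 j)).
  apply: measurable_fun_pair.
    exact: (measurableT_comp (measurable_tnth i) measurable_fst).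
  exact: (measurableT_comp (measurable_tnth j) measurable_snd).
pose X : {mfun (k.-tuple T * l.-tuple T)%type >-> (T * T)%type} :=
  HB.pack (fun u : k.-tuple T * l.-tuple T => (tnth u.1 i, tnth u.2 j))
    (isMeasurableFun.Build _ _ _ _ _ mX).
apply/esym; apply: (@product_measure_unique _ _ _ _ _ (P i) (Q j)
  (distribution (prodP P \x prodP Q) X)) => // B C mB mC.
rewrite -[LHS]/((prodP P \x prodP Q)
  ([set u | B (tnth u i)] `*` [set u | C (tnth u j)])).
have mtnth n a (D : set T) : measurable D -> measurable [set u : n.-tuple T | D (tnth u
  a)].
  by move=> mD; rewrite -[X in measurable X]setTI; exact: measurable_tnth.
rewrite product_measure1E; [|exact: mtnth|exact: mtnth].
by congr (_ * _); exact: prodP_tnth.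
Qed.

End marginals.

Section sorting.
Variable R : realType.
Local Notation Omega := (unitI R).
Local Open Scope ereal_scope.

Variable f : Omega -> Omega.
Hypothesis mf : measurable_fun setT f.

Definition increasing_tuples n : set (n.-tuple Omega) :=
  [set u | increasing (fun a => f (tnth u a))].

Let mftnth n (i : 'I_n) : measurable_fun setT (fun u : n.-tuple Omega =>
  valI (f (tnth u i))).
Proof.
apply: measurableT_comp; first exact: measurable_valI.
by apply: measurableT_comp => //; exact: measurable_tnth.
Qed.

Lemma measurable_increasing_tuples n : measurable (@increasing_tuples n).
Proof.
rewrite (_ : @increasing_tuples n = \bigcap_(i in [set: 'I_n])
    \bigcap_(j in [set j : 'I_n | (i < j)%N])
      [set u | (valI (f (tnth u i)) < valI (f (tnth u j)))%R]).
  apply: fin_bigcap_measurable => // i _; apply: fin_bigcap_measurable => // j _.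
  by apply: measurable_ltr_set; exact: mftnth.
apply/seteqP; split => u /=.
  by move=> /forallP uinc i _ j /= ij; have /forallP/(_ j)/implyP := uinc i; exact.
move=> uinc; apply/forallP => i; apply/forallP => j; apply/implyP => ij.
exact: uinc ij.
Qed.

Lemma increasing_reindex n (s : 'S_n) (u : n.-tuple Omega) :
  increasing (fun a => f (tnth u (s a))) = 
  increasing (fun a => f (tnth (reindex_tuple s u) a)).
Proof. by apply: eq_forallb => i; apply: eq_forallb => j; rewrite !tnth_mktuple. Qed.

Hypothesis f_atomless : forall a, lebI (f @^-1` [set f a]) = 0.

Let lam : probability Omega R := lebI.

(** Ties between two given samples are null and there are finitely many pairs. Assuming only that
    the fibres of [f] are null covers the [f] of a Latinon as well as the identity, which orders the
    entries themselves. *)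
Lemma ae_sorted n : {ae prodP (fun _ : 'I_n => lam), forall u,
  exists s : 'S_n, forall t : 'S_n,
    increasing (fun a => f (tnth u (t a))) = (t == s)}.
Proof.
pose D := [set p : Omega * Omega | valI (f p.1) = valI (f p.2)].
have mD : measurable D.
  apply: measurable_eqr_set.
    by apply: measurableT_comp; [exact: measurable_valI|exact: measurableT_comp].
  by apply: measurableT_comp; [exact: measurable_valI|exact: measurableT_comp].
(* The section of the tie set at [a] is the fibre of [f] through [a]. *)
have D0 : (lam \x lam) D = 0.
  rewrite /product_measure1 integral0_eq// => a _ /=.
  rewrite -[RHS](f_atomless a); congr lebI; apply/seteqP; split => b.
    by move/xsectionP => /= /valI_inj.
  by move=> /= fba; apply/xsectionP; rewrite /D /= fba.
have : {ae prodP (fun _ : 'I_n => lam), forall u, forall ij : 'I_n * 'I_n,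
    ij.1 != ij.2 -> ~ D (tnth u ij.1, tnth u ij.2)}.
  apply: filter_forall => -[i j] /=; case: (eqVneq i j) => [_|ij]; first exact: aeW.
  exists [set u | D (tnth u i, tnth u j)]; split.
  - rewrite -[X in measurable X]setTI.
    have mX : measurable_fun setT (fun u : n.-tuple Omega => (tnth u i, tnth u j)).
      by apply: measurable_fun_pair; exact: measurable_tnth.
    exact: mX.
  - by rewrite (prodP_pair _ ij).
  - by move=> u /= /not_implyP[_ /contrapT].
apply: filterS => u uD.
have inj : injective (fun i => valI (f (tnth u i))).
  move=> i j uij; apply/eqP; apply: contraPT uij => ij; exact: (uD (i, j) ij).
by have [s hs] := exists_unique_sort inj; exists s.
Qed.

End sorting.

Section finite_disjoint.
Context d (T : measurableType d) (R : realType) (mu : probability T R).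
Variables (I : finType) (P : pred I) (F : I -> set T).
Hypotheses (mF : forall i, measurable (F i))
  (tF : forall i j u, F i u -> F j u -> i = j).
Local Open Scope ereal_scope.

Lemma measure_finU : mu (\bigcup_(i in [set i | P i]) F i) = \sum_(i | P i) mu (F i).
Proof.
rewrite -[RHS]big_filter.
rewrite (_ : \bigcup_(i in _) F i = \big[setU/set0]_(i <- [seq i <- index_enum I | P
  i]) F i).
  have : uniq [seq i <- index_enum I | P i] by rewrite filter_uniq// index_enum_uniq.
  elim: [seq i <- index_enum I | P i] => [|i s IH /= /andP[is_ us]].
    by rewrite !big_nil measure0.
  rewrite !big_cons measureU; [by congr (_ + _);
    exact: IH|exact: mF|by apply: bigsetU_measurable|].
  apply/seteqP; split => // u [Fi]; rewrite -bigcup_seq => -[j /= js Fj].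
  by move: js; rewrite -(tF Fi Fj) (negbTE is_).
rewrite -bigcup_seq; apply/seteqP; split => u [i /= Pi Fi]; exists i => //=.
  by rewrite mem_filter Pi mem_index_enum.
by move: Pi; rewrite mem_filter => /andP[].
Qed.

Lemma sum_measure_le B : measurable B -> (forall i, P i -> F i `<=` B) ->
  \sum_(i | P i) mu (F i) <= mu B.
Proof.
move=> mB FB; rewrite -measure_finU; apply: le_measure; rewrite ?inE//.
  by apply: fin_bigcup_measurable => //; exact: finite_finset.
by move=> u [i Pi Fi]; exact: FB Fi.
Qed.

End finite_disjoint.

Section sorted.
Variable R : realType.
Local Notation Omega := (unitI R).
Local Open Scope ereal_scope.

(* [lebI] itself is a bare set function; [lam] carries the probability structure. *)
Definition lam : probability Omega R := lebI.

Lemma measurable_unitI_set1 (a : Omega) : measurable [set a].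
Proof.
rewrite (_ : [set a] = [set x | valI x = cst (valI a) x]).
  by apply: measurable_eqr_set; [exact: measurable_valI|exact: measurable_cst].
by apply/seteqP; split => x /= => [->|/valI_inj].
Qed.

Lemma lebI_set1 (a : Omega) : lebI [set a] = 0.
Proof. by rewrite /lebI image_set1 lebesgue_measure_set1. Qed.

Lemma measure_preserving_atomless f (a : Omega) :
  measure_preserving f -> lebI (f @^-1` [set f a]) = 0.
Proof. by move=> [_ fE]; rewrite fE ?lebI_set1//; exact: measurable_unitI_set1. Qed.

Definition sorted_tuples n : set (n.-tuple Omega) := @increasing_tuples R id n.

Lemma measurable_sorted_tuples n : measurable (@sorted_tuples n).
Proof. exact: measurable_increasing_tuples. Qed.

Lemma sorted_tuples_lt n (u : n.-tuple Omega) i j : sorted_tuples u ->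
  (valI (tnth u i) < valI (tnth u j))%R = (i < j)%N.
Proof.
move=> /forallP uinc.
have ult (a b : 'I_n) : (a < b)%N -> (valI (tnth u a) < valI (tnth u b))%R.
  by move=> ab; have /forallP/(_ b)/implyP/(_ ab) := uinc a.
case: (ltngtP i j) => [/ult//|/ult ji|/val_inj ->]; last by rewrite ltxx.
by apply/negbTE; rewrite -leNgt ltW.
Qed.

Lemma reindex_sorted_tuples_lt n (s : 'S_n) (u : n.-tuple Omega) i j :
  (reindex_tuple s @^-1` @sorted_tuples n) u ->
  (valI (tnth u (s i)) < valI (tnth u (s j)))%R = (i < j)%N.
Proof. by move=> /sorted_tuples_lt <-; rewrite !tnth_mktuple. Qed.

Lemma measurable_reindex_sorted n (s : 'S_n) :
  measurable (reindex_tuple s @^-1` @sorted_tuples n).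
Proof.
rewrite -[X in measurable X]setTI.
apply: measurable_reindex_tuple => //; exact: measurable_sorted_tuples.
Qed.

Lemma reindex_sorted_tuplesE n (s : 'S_n) (u : n.-tuple Omega) :
  (reindex_tuple s @^-1` @sorted_tuples n) u =
  [forall i : 'I_n, forall j : 'I_n,
    (i < j)%N ==> (valI (tnth u (s i)) < valI (tnth u (s j)))%R].
Proof.
rewrite -[LHS]/(is_true (increasing _)); congr is_true.
by apply: eq_forallb => i; apply: eq_forallb => j; rewrite !tnth_mktuple.
Qed.

Lemma reindex_sorted_tuples_unique n (s t : 'S_n) (u : n.-tuple Omega) :
  (reindex_tuple s @^-1` @sorted_tuples n) u ->
  (reindex_tuple t @^-1` @sorted_tuples n) u -> s = t.
Proof.
move=> us ut.
have u_inj : injective (fun i => valI (tnth u i)).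
  move=> i j uij; apply: (@perm_inj _ s^-1%g); apply: val_inj.
  have lt_us (a b : 'I_n) : (a < b)%N = (valI (tnth u (s a)) < valI (tnth u (s b)))%R.
    by rewrite (reindex_sorted_tuples_lt _ _ us).
  case: (ltngtP (s^-1%g i) (s^-1%g j)) => // ;
    by rewrite lt_us !permKV uij ltxx.
have [r hr] := exists_unique_sort u_inj.
rewrite reindex_sorted_tuplesE hr in us; rewrite reindex_sorted_tuplesE hr in ut.
by rewrite (eqP us) (eqP ut).
Qed.

Lemma sum_prodP_sorted n :
  \sum_(s : 'S_n) prodP (fun _ : 'I_n => lam) (reindex_tuple s @^-1` @sorted_tuples n)
    = 1.
Proof.
rewrite -(measure_finU _ xpredT); [|exact: measurable_reindex_sorted|exact:
  reindex_sorted_tuples_unique].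
set A := \bigcup_(_ in _) _.
have mA : measurable A.
  apply: fin_bigcup_measurable; first exact: finite_finset.
  by move=> s _; exact: measurable_reindex_sorted.
have A0 : prodP (fun _ : 'I_n => lam) (~` A) = 0.
  apply/negligibleP; first exact: measurableC.
  have : {ae prodP (fun _ : 'I_n => lam), forall u, A u}.
    have := @ae_sorted R id (@measurable_id _ _ _) (fun a => lebI_set1 a) n.
    apply: filterS => u [s hs]; exists s => //.
    by rewrite reindex_sorted_tuplesE; have := hs s; rewrite eqxx.
  by [].
by rewrite -[LHS](measureU0 mA (measurableC mA) A0) setUv; exact: probability_setT.
Qed.

(** By exchangeability the orders are equally likely, and the probabilities of the [n!] orders add
    up to 1. *)
Lemma prodP_sorted n : prodP (fun _ : 'I_n => lam) (@sorted_tuples n) = ((n`!%:R)^-1)%:E.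
Proof.
have := sum_prodP_sorted n.
rewrite (eq_bigr (fun=> prodP (fun _ : 'I_n => lam) (@sorted_tuples n))); last first.
  by move=> s _; rewrite prodP_reindex//; [exact: perm_inj|exact:
    measurable_sorted_tuples].
rewrite -[prodP _ _]fineK ?fin_num_measure//; last exact: measurable_sorted_tuples.
rewrite sumEFin sumr_const card_Sn => -[] cn1; congr EFin.
have nz : n`!%:R != 0%R :> R by rewrite pnatr_eq0 -lt0n fact_gt0.
by apply: (mulIf nz); rewrite mulVf// mulr_natr cn1.
Qed.

End sorted.

Section sorted_events.
Variable R : realType.
Local Notation Omega := (unitI R).
Local Open Scope ereal_scope.
Context d (U : measurableType d) (M : probability U R).
Variables (n : nat) (K : U -> probability (n.-tuple Omega) R).
Hypothesis kK : is_kernel K.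
Hypothesis K_sorted : forall s : 'S_n,
  \int[M]_u K u (reindex_tuple s @^-1` @sorted_tuples R n) = ((n`!%:R)^-1)%:E.

(* Almost surely no ties occur under [lam], but ties under [K] are not excluded,
   whence only an inequality. *)
Lemma sorted_event_le (Q : set (n.-tuple Omega)) (P : pred 'S_n) :
  measurable Q ->
  (forall (s : 'S_n) u, (reindex_tuple s @^-1` @sorted_tuples R n) u -> Q u <-> P s) ->
  \int[M]_u K u Q <= prodP (fun _ : 'I_n => lam R) Q.
Proof.
move=> mQ QP.
pose c : \bar R := ((n`!%:R)^-1)%:E.
have lamS (s : 'S_n) : prodP (fun _ : 'I_n =>
  lam R) (reindex_tuple s @^-1` @sorted_tuples R n) = c.
  rewrite prodP_reindex ?prodP_sorted//; first exact: perm_inj.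
  exact: measurable_sorted_tuples.
have mK A : measurable A -> measurable_fun setT (fun u => K u A) by exact: kK.
have PQ : \sum_(s : 'S_n | P s) c <= prodP (fun _ : 'I_n => lam R) Q.
  under eq_bigr => s _ do rewrite -(lamS s).
  apply: sum_measure_le => //; first exact: measurable_reindex_sorted.
    exact: reindex_sorted_tuples_unique.
  by move=> s Ps u us; apply/(QP _ _ us).
apply: le_trans PQ.
have c1 : \sum_(s : 'S_n | P s) c + \sum_(s : 'S_n | ~~ P s) c = 1.
  rewrite -(sum_prodP_sorted R n) [RHS](bigID P)/=.
  by congr (_ + _); apply: eq_bigr => s _; rewrite lamS.
(* [Q] is disjoint from every strict order violating [P], so their masses together are at most 1;
   cancelling the violating orders, each of averaged mass [c], bounds the mass of [Q]. *)
have: \int[M]_u K u Q + \sum_(s : 'S_n | ~~ P s) c <= 1.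
  under eq_bigr => s _ do rewrite /c -(K_sorted s).
  rewrite -big_filter -ge0_integral_sum//; last first.
    by move=> s; apply: mK; exact: measurable_reindex_sorted.
  rewrite -ge0_integralD; [|exact: measurableT|by []|exact: mK|
    by move=> u _; exact: sume_ge0|
    by apply: emeasurable_sum => s; apply: mK; exact: measurable_reindex_sorted].
  apply: integral_probability_le => [|u|u].
  - apply: emeasurable_funD; first exact: mK.
    by apply: emeasurable_sum => s; by apply: mK; exact: measurable_reindex_sorted.
  - by apply: adde_ge0 => //; exact: sume_ge0.
  rewrite big_filter -(@probability_setT _ _ _ (K u)) -[in leRHS](setvU Q) measureU//;
    last 2 first.
    exact: measurableC.
    by rewrite setICl.
  rewrite [leRHS]addeC leeD2l//.
  apply: sum_measure_le; [exact: measurable_reindex_sorted|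
     exact: reindex_sorted_tuples_unique|exact: measurableC|].
  by move=> s Ps v vs /(QP _ _ vs); rewrite (negbTE Ps).
by rewrite -c1 leeD2rE// sumEFin.
Qed.

End sorted_events.

(** * Pattern densities *)

Section patterns.
Variables k l : nat.
Implicit Types (e : 'I_(k * l) -> 'I_k * 'I_l) (A : 'M[nat]_(k, l)).

(** Lists the cells by increasing value, which makes a pattern an order of sampling. Values start at
    1 but ordinals at 0, hence [i.+1]. *)
Lemma pattern_index A : pattern A ->
  exists e, forall i, A (e i).1 (e i).2 = i.+1.
Proof.
move=> pA.
have /fin_all_exists[e Ae] (i : 'I_(k * l)) : exists ab : 'I_k * 'I_l, A ab.1 ab.2 = i.+1.
  by have [|ab [Aab _]] := pA i.+1; [exact: ltn_ord|exists ab].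
by exists e.
Qed.

Lemma index_bij e A : (forall i, A (e i).1 (e i).2 = i.+1) -> bijective e.
Proof.
move=> Ae; apply: inj_card_bij; last by rewrite card_prod !card_ord.
by move=> i j eij; apply: val_inj; apply: succn_inj; rewrite -!Ae eij.
Qed.

Lemma index_pattern e : bijective e ->
  exists2 A, pattern A & forall i, A (e i).1 (e i).2 = i.+1.
Proof.
move=> [e' eK e'K]; exists (\matrix_(a, b) (e' (a, b)).+1).
  move=> m /andP[m0 mkl]; have mkl' : (m.-1 < k * l)%N by rewrite prednK.
  exists (e (Ordinal mkl')); split.
    by rewrite mxE -surjective_pairing eK prednK.
  move=> [a b]; rewrite mxE /= => abm; rewrite -(e'K (a, b)); congr e.
  by apply: val_inj; rewrite /= -abm.
by move=> i; rewrite mxE -surjective_pairing eK.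
Qed.

(** Reading the cells in the order of [A] turns all pairwise comparisons into monotonicity of a
    single list. *)
Lemma pattern_eventE (R : realType) e A :
  (forall i, A (e i).1 (e i).2 = i.+1) ->
  pattern_event A = flatten_tuple e @^-1` @sorted_tuples R (k * l).
Proof.
move=> Ae; have [e' eK e'K] := index_bij Ae.
apply/seteqP; split => z.
  move=> zA; rewrite /sorted_tuples /increasing_tuples /=.
  apply/forallP => i; apply/forallP => j; apply/implyP => ij.
  by rewrite !tnth_mktuple; apply/zA; rewrite !Ae.
move=> /= /sorted_tuples_lt zs a a' b b'.
have zE i : tnth (tnth z (e i).1) (e i).2 = tnth (flatten_tuple e z) i.
  by rewrite tnth_mktuple.
have := zE (e' (a, b)); have := zE (e' (a', b')); rewrite !e'K /= => -> ->.
rewrite zs.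
by have := Ae (e' (a, b)); have := Ae (e' (a', b')); rewrite !e'K /= => -> ->.
Qed.

End patterns.

(** The sums in [density] range over permutations that depend on the sampled points. *)
Lemma measurable_sum_cond d (T : measurableType d) (R : realType) (I : finType)
    (b : I -> T -> bool) (F : I -> T -> \bar R) :
  (forall i, measurable [set x | b i x]) ->
  (forall i, measurable_fun setT (F i)) ->
  measurable_fun setT (fun x => \sum_(i | b i x) F i x)%E.
Proof.
move=> mb mF; under eq_fun do rewrite big_mkcond.
apply: emeasurable_sum => i; apply: measurable_fun_ifT => //.
apply: (measurable_fun_bool true).
by rewrite setTI (_ : _ @^-1` _ = [set x | b i x]).
Qed.

Section density.
Variable R : realType.
Local Notation Omega := (unitI R).
Local Open Scope ereal_scope.
Variable W : Omega * Omega -> probability Omega R.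
Hypothesis kW : is_kernel W.

Definition points_law k l : probability (k.-tuple Omega * l.-tuple Omega)%type R :=
  prodP (fun _ : 'I_k => lam R) \x prodP (fun _ : 'I_l => lam R).

Lemma integral_points_law k l (h : k.-tuple Omega * l.-tuple Omega -> \bar R) :
  measurable_fun setT h -> (forall p, 0 <= h p) ->
  \int[points_law k l]_p h p =
  \int[prodP (fun _ : 'I_k => lam R)]_x \int[prodP (fun _ : 'I_l => lam R)]_y h (x, y).
Proof. exact: fubini_tonelli1. Qed.

Definition entries_law k l n (e : 'I_n -> 'I_k * 'I_l)
    (p : k.-tuple Omega * l.-tuple Omega) : probability (n.-tuple Omega) R :=
  prodP (fun i => W (tnth p.1 (e i).1, tnth p.2 (e i).2)).

Lemma measurable_entry k l (ab : 'I_k * 'I_l) :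
  measurable_fun setT (fun p : k.-tuple Omega * l.-tuple Omega =>
    (tnth p.1 ab.1, tnth p.2 ab.2)).
Proof.
apply: measurable_fun_pair.
  exact: (measurableT_comp (measurable_tnth ab.1) measurable_fst).
exact: (measurableT_comp (measurable_tnth ab.2) measurable_snd).
Qed.

Lemma is_kernel_entries_law k l n (e : 'I_n -> 'I_k * 'I_l) :
  is_kernel (entries_law e).
Proof.
apply: (@is_kernel_prodP _ _ R _ Omega n
  (fun i p => W (tnth p.1 (e i).1, tnth p.2 (e i).2))) => i.
exact: is_kernel_comp (measurable_entry (e i)) kW.
Qed.

Definition perm_index k l n (s : 'S_k) (t : 'S_l) (e : 'I_n -> 'I_k * 'I_l) i :=
  (s (e i).1, t (e i).2).

Lemma integral_prodP_reindex n (s : 'S_n) (h : n.-tuple Omega -> \bar R) :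
  measurable_fun setT h -> (forall u, 0 <= h u) ->
  \int[prodP (fun _ : 'I_n => lam R)]_u h (reindex_tuple s u) =
  \int[prodP (fun _ : 'I_n => lam R)]_u h u.
Proof.
move=> mh h0.
rewrite -[LHS](ge0_integral_pushforward (measurable_reindex_tuple s)
  (prodP (fun _ : 'I_n => lam R)) (D := setT) (f := h))//.
apply: eq_measure_integral => A mA _.
by rewrite [LHS]prodP_reindex//; exact: perm_inj.
Qed.

(** The rows and the columns are i.i.d. samples, so renaming them does not change the averaged law
    of the entries. *)
Lemma integral_entries_law_perm k l n (s : 'S_k) (t : 'S_l) (e : 'I_n -> 'I_k * 'I_l) A :
  measurable A ->
  \int[points_law k l]_p entries_law (perm_index s t e) p A =
  \int[points_law k l]_p entries_law e p A.
Proof.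
move=> mA.
have entries_perm p : entries_law (perm_index s t e) p =
    entries_law e (reindex_tuple s p.1, reindex_tuple t p.2).
  by rewrite /entries_law; congr prodP; apply/funext => i; rewrite !tnth_mktuple.
have mE : measurable_fun setT (fun p => entries_law e p A) by exact:
  is_kernel_entries_law.
pose g (p : k.-tuple Omega * l.-tuple Omega) := entries_law e p A.
rewrite (eq_integral (fun p => g (reindex_tuple s p.1, reindex_tuple t p.2))); last first.
  by move=> p _; rewrite entries_perm.
have mr : measurable_fun setT (fun p : k.-tuple Omega * l.-tuple Omega =>
    (reindex_tuple s p.1, reindex_tuple t p.2)).
  apply: measurable_fun_pair.
    exact: (measurableT_comp (measurable_reindex_tuple s) measurable_fst).
  exact: (measurableT_comp (measurable_reindex_tuple t) measurable_snd).
rewrite [LHS]integral_points_law; [|exact: (measurableT_comp mE mr)|by []].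
rewrite [RHS]integral_points_law; [|exact: mE|by []].
rewrite -(@integral_prodP_reindex k s (fun x => \int[prodP (fun _ : 'I_l =>
  lam R)]_y g (x, y))); last 2 first.
- by apply: measurable_fun_fubini_tonelli_F.
- by move=> u; exact: integral_ge0.
apply: eq_integral => x _.
rewrite (@integral_prodP_reindex l t (fun y => g (reindex_tuple s x, y)))//.
exact: (measurableT_comp mE (pair1_measurable _)).
Qed.

Variable f : Omega -> Omega.
Hypothesis mf : measurable_fun setT f.

Let sorted_by n (s : 'S_n) (u : n.-tuple Omega) := increasing (fun a => f (tnth u (s a))).

Let measurable_sorted_by n (s : 'S_n) : measurable [set u | sorted_by s u].
Proof.
rewrite -[X in measurable X]setTI.
rewrite (_ : [set u | _] = reindex_tuple s @^-1` @increasing_tuples R f n); last first.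
  apply/seteqP; split => u; rewrite /= /increasing_tuples /= -increasing_reindex//.
by apply: measurable_reindex_tuple => //; exact: measurable_increasing_tuples.
Qed.

Let density_integrand k l (e : 'I_(k * l) -> 'I_k * 'I_l)
    (p : k.-tuple Omega * l.-tuple Omega) : \bar R :=
  \sum_(s : 'S_k | sorted_by s p.1) \sum_(t : 'S_l | sorted_by t p.2)
    entries_law (perm_index s t e) p (@sorted_tuples R (k * l)).

Let measurable_density_integrand k l (e : 'I_(k * l) -> 'I_k * 'I_l) :
  measurable_fun setT (density_integrand e).
Proof.
have mk (s : 'S_k) : measurable [set p : k.-tuple Omega * l.-tuple Omega | sorted_by s
  p.1].
  rewrite -[X in measurable X]setTI.
  exact: (@measurable_fst _ _ (k.-tuple Omega) (l.-tuple Omega) measurableT _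
    (measurable_sorted_by s)).
have ml (t : 'S_l) : measurable [set p : k.-tuple Omega * l.-tuple Omega | sorted_by t
  p.2].
  rewrite -[X in measurable X]setTI.
  exact: (@measurable_snd _ _ (k.-tuple Omega) (l.-tuple Omega) measurableT _
    (measurable_sorted_by t)).
apply: (measurable_sum_cond mk) => s; apply: (measurable_sum_cond ml) => t.
by apply: is_kernel_entries_law; exact: measurable_sorted_tuples.
Qed.

Let density_integrand_ge0 k l (e : 'I_(k * l) -> 'I_k * 'I_l) p :
  0 <= density_integrand e p.
Proof. by apply: sume_ge0 => s _; exact: sume_ge0. Qed.

Lemma densityE k l (A : 'M[nat]_(k, l)) (e : 'I_(k * l) -> 'I_k * 'I_l) :
  (forall i, A (e i).1 (e i).2 = i.+1) ->
  density W f A = \int[points_law k l]_p density_integrand e p.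
Proof.
move=> Ae; rewrite integral_points_law; [|exact: measurable_density_integrand|exact:
  density_integrand_ge0].
apply: eq_integral => x _; apply: eq_integral => y _.
apply: eq_bigr => s _; apply: eq_bigr => t _.
rewrite (pattern_eventE _ Ae).
rewrite (@prodP_flatten _ _ R _ _ _ e (fun ab =>
  W (tnth x (s ab.1), tnth y (t ab.2)))) //.
  exact: bij_inj (index_bij Ae).
exact: measurable_sorted_tuples.
Qed.

Hypothesis f_atomless : forall a, lebI (f @^-1` [set f a]) = 0.

Let ae_points_sorted k l : {ae points_law k l, forall p,
  exists s0 : 'S_k, exists t0 : 'S_l,
    (forall s, sorted_by s p.1 = (s == s0)) /\
    (forall t, sorted_by t p.2 = (t == t0))}.
Proof.
have lift_ae d1 d2 (T1 : measurableType d1) (T2 : measurableType d2)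
    (P1 : probability T1 R) (P2 : probability T2 R) (Q1 : set T1) (Q2 : set T2) :
    {ae P1, forall x, Q1 x} -> {ae P2, forall y, Q2 y} ->
    {ae P1 \x P2, forall p, Q1 p.1 /\ Q2 p.2}.
  move=> [N1 [mN1 N10 QN1]] [N2 [mN2 N20 QN2]].
  have m1 : measurable (N1 `*` [set: T2]) by exact: measurableX.
  have m2 : measurable ([set: T1] `*` N2) by exact: measurableX.
  have n1 : (P1 \x P2) (N1 `*` setT) = 0 
    by transitivity (P1 N1 * P2 setT); [exact: product_measure1E|rewrite N10 mul0e].
  have n2 : (P1 \x P2) (setT `*` N2) = 0 
    by transitivity (P1 setT * P2 N2); [exact: product_measure1E|rewrite N20 mule0].
  exists ((N1 `*` setT) `|` (setT `*` N2)); split.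
  - exact: measurableU.
  - exact: etrans (measureU0 m1 m2 n2) n1.
  - move=> p /= /not_andP[/QN1|/QN2]; [by left|by right].
have := lift_ae _ _ _ _ _ _ _ _ (ae_sorted mf f_atomless k) (ae_sorted mf f_atomless l).
by apply: filterS => p [[s0 hs] [t0 ht]]; exists s0, t0.
Qed.

Let density_integrand_ae k l e p (s0 : 'S_k) (t0 : 'S_l) :
  (forall s, sorted_by s p.1 = (s == s0)) ->
  (forall t, sorted_by t p.2 = (t == t0)) ->
  density_integrand e p = entries_law (perm_index s0 t0 e) p (@sorted_tuples R (k * l)).
Proof.
move=> hs ht; rewrite /density_integrand (eq_bigl _ _ hs) big_pred1_eq.
by rewrite (eq_bigl _ _ ht) big_pred1_eq.
Qed.

(** This eliminates [f]: equal densities of all patterns make every order of the cells equally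
    likely, without first naming the points by [f]. Add up the densities of all row and column
    permutations of the pattern given by [e], then divide by their number. *)
Lemma density_average k l (c : R) :
  (forall A : 'M[nat]_(k, l), pattern A -> density W f A = c%:E) ->
  forall e : 'I_(k * l) -> 'I_k * 'I_l, bijective e ->
  \int[points_law k l]_p entries_law e p (@sorted_tuples R (k * l)) = c%:E.
Proof.
move=> dc e be.
have mS : measurable (@sorted_tuples R (k * l)) by exact: measurable_sorted_tuples.
(* Permuting rows and columns of a numbering of the cells gives again a numbering, hence a pattern
   of density [c]. *)
have Dc s t : \int[points_law k l]_p density_integrand (perm_index s t e) p = c%:E.
  have [|A pA Ae] := @index_pattern k l (perm_index s t e);
    last by rewrite -(densityE Ae); exact: dc.
  have [e' eK e'K] := be.
  exists (fun ab => e' ((s^-1)%g ab.1, (t^-1)%g ab.2)).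
    by move=> i; rewrite /perm_index /= !permK -surjective_pairing eK.
  by move=> [a b]; rewrite /perm_index /= e'K /= !permKV.
have : \sum_(st : 'S_k * 'S_l) c%:E =
       \sum_(st : 'S_k * 'S_l) \int[points_law k l]_p entries_law e p (@sorted_tuples R
         (k * l)).
  under eq_bigr => st _ do rewrite -(Dc st.1 st.2).
  under [RHS]eq_bigr => st _ do rewrite -(integral_entries_law_perm st.1 st.2 e mS).
  rewrite -!ge0_integral_sum//.
  - apply: ge0_ae_eq_integral => //.
    + by apply: emeasurable_sum => st; exact: measurable_density_integrand.
    + by apply: emeasurable_sum => st; apply: is_kernel_entries_law; exact: mS.
    + by move=> p _; apply: sume_ge0 => st _; exact: density_integrand_ge0.
    + by move=> p _; exact: sume_ge0.
    move: (ae_points_sorted k l); apply: filterS => p [s0 [t0 [hs ht]]] _.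
    under eq_bigr => st _ do rewrite (density_integrand_ae _ hs ht).
    (* At almost all points a single renaming [(s0, t0)] sorts. Composing with it permutes the index
       set of the sum, so the sum no longer depends on it. *)
    pose r (st : 'S_k * 'S_l) := ((st.1 * s0)%g, (st.2 * t0)%g).
    have r_inj : injective r by move=> [s t] [s' t'] [/mulIg -> /mulIg ->].
    rewrite [RHS](reindex_inj r_inj); apply: eq_bigr => st _.
    congr (entries_law _ p _); apply/funext => i.
    by rewrite /perm_index /= !permM.
  - by move=> st; apply: is_kernel_entries_law; exact: mS.
  - by move=> st; exact: measurable_density_integrand.
have kN : is_kernel (entries_law e) by exact: is_kernel_entries_law.
have Jfin : \int[points_law k l]_p entries_law e p (@sorted_tuples R (k * l)) \is a
  fin_num.
  apply: (@integral_probability_fin_num _ _ _ _ _ 1) => //; first exact: kN.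
  by move=> p; exact: probability_le1.
(* Both sides are now the same positive multiple, the number of pairs [(s, t)]. *)
rewrite -(fineK Jfin) => cc.
move: cc; rewrite !sumEFin !sumr_const => -[] /pmulrnI -> //.
by apply/card_gt0P; exists (1%g, 1%g).
Qed.

(** Each sampled pair of points has law [lam R \x lam R] and so avoids the null set almost surely;
    then all entries are i.i.d. uniform and every order of them has the same probability. *)
Lemma density_uniform k l (A : 'M[nat]_(k, l)) :
  {ae lam R \x lam R, forall p, forall S, measurable S -> W p S = lam R S} ->
  pattern A -> density W f A = (((k * l)`!%:R)^-1)%:E.
Proof.
move=> [N [mN N0 WN]] /pattern_index[e Ae].
have W_ae : {ae points_law k l, forall p, forall ab : 'I_k * 'I_l,
    forall S, measurable S -> W (tnth p.1 ab.1, tnth p.2 ab.2) S = lam R S}.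
  apply: filter_forall => ab.
  exists [set p | N (tnth p.1 ab.1, tnth p.2 ab.2)]; split.
  - by rewrite -[X in measurable X]setTI; exact: measurable_entry.
  - exact: etrans (prodP_cross _ _ _ _ mN) N0.
  - by move=> p pW; apply: WN; exact: pW.
rewrite (densityE Ae) -[RHS]mule1 -(@probability_setT _ _ _ (points_law k l))
  -integral_cst//.
apply: ge0_ae_eq_integral => //; first exact: measurable_density_integrand.
  by move=> p _; rewrite lee_fin invr_ge0.
move: W_ae; apply: filterS2 (ae_points_sorted k l) => p [s0 [t0 [hs ht]]] Wp _.
rewrite (density_integrand_ae _ hs ht) /= -prodP_sorted; apply: eq_prodP => [i S mS|].
  exact: (Wp (perm_index s0 t0 e i)).
exact: measurable_sorted_tuples.
Qed.

End density.

(** * Integration tools *)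

Section integral_tools.
Local Open Scope ereal_scope.

Lemma is_kernel_product d (X : measurableType d) d1 (T1 : measurableType d1)
    d2 (T2 : measurableType d2) (R : realType)
    (P : X -> probability T1 R) (Q : X -> probability T2 R) :
  is_kernel P -> is_kernel Q ->
  @is_kernel _ X R _ (T1 * T2)%type (fun x => P x \x Q x).
Proof.
move=> kP kQ.
pose G : set (set (T1 * T2)) :=
  [set A `*` B | A in measurable & B in measurable].
apply: (@is_kernel_generated _ X R _ _ G).
- by rewrite measurable_prod_measurableType.
- move=> _ _ [A1 mA1 [A2 mA2 <-]] [B1 mB1 [B2 mB2 <-]].
  exists (A1 `&` B1); first exact: measurableI.
  exists (A2 `&` B2); first exact: measurableI.
  by rewrite setXI.
- move=> _ [A mA [B mB <-]].
  apply: (eq_measurable_fun (fun x => P x A * Q x B)).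
    by move=> x _; apply/esym; exact: product_measure1E.
  by apply: emeasurable_funM; [exact: kP|exact: kQ].
Qed.

(** The value is the mass of [D] under the product of the Dirac measure at [z] and [Q x]; joint
    measurability in both parameters thus reduces to products of kernels. *)
Lemma measurable_kernel_xsection d (X : measurableType d) d1 (T1 : measurableType d1)
    d2 (T2 : measurableType d2) (R : realType) (Q : X -> probability T2 R)
    (D : set (T1 * T2)) :
  is_kernel Q -> measurable D ->
  measurable_fun setT (fun zx : T1 * X => Q zx.2 (xsection D zx.1)).
Proof.
move=> kQ mD.
pose P (zx : T1 * X) : probability T1 R := \d_(zx.1).
have kP : is_kernel P.
  move=> A mA.
  have -> : (fun zx => P zx A) = (fun zx => (\1_A zx.1)%:E) by [].
  apply/measurable_EFinP.
  have mi : measurable_fun setT (\1_A : T1 -> R) by exact: measurable_indic.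
  exact: (measurableT_comp mi measurable_fst).
have kQ' : @is_kernel _ (T1 * X)%type R _ T2 (fun zx => Q zx.2).
  exact: is_kernel_comp measurable_snd kQ.
apply: (eq_measurable_fun (fun zx => (P zx \x Q zx.2) D)); last first.
  exact: (is_kernel_product kP kQ').
move=> [z x] _ /=; rewrite /product_measure1 /= integral_dirac//; last first.
  exact: measurable_fun_xsection.
by rewrite diracT mul1e.
Qed.

Lemma integral_prodP_cons d (T : measurableType d) (R : realType) n
    (P : 'I_n.+1 -> probability T R) (h : n.+1.-tuple T -> \bar R) :
  measurable_fun setT h -> (forall u, 0 <= h u) ->
  \int[prodP P]_u h u = \int[P ord0]_a \int[prodP (fun i => P (lift ord0 i))]_v
     h (cons_pair (a, v)).
Proof.
move=> mh h0.
rewrite [LHS](ge0_integral_pushforward (@measurable_cons_pair _ T n)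
  (P ord0 \x prodP (fun i => P (lift ord0 i))) (D := setT) (f := h))//.
apply: (@fubini_tonelli1 _ _ _ _ R (P ord0) (prodP (fun i => P (lift ord0 i)))
  (h \o @cons_pair _ T n)) => //=.
by apply: measurableT_comp => //; exact: measurable_cons_pair.
Qed.

Lemma integral_iid_pair d (T : measurableType d) (R : realType)
    (mu : probability T R) (h : T * T -> \bar R) :
  measurable_fun setT h -> (forall u, 0 <= h u) ->
  \int[prodP (fun _ : 'I_2 => mu)]_u h (tnth u ord0, tnth u ord_max) =
  \int[mu \x mu]_p h p.
Proof.
move=> mh h0.
have mX : measurable_fun setT (fun u : 2.-tuple T => (tnth u ord0, tnth u ord_max)).
  by apply: measurable_fun_pair; exact: measurable_tnth.
transitivity (\int[pushforward (prodP (fun _ : 'I_2 => mu))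
    (fun u : 2.-tuple T => (tnth u ord0, tnth u ord_max))]_q h q).
  apply/esym; exact: (ge0_integral_pushforward mX (prodP (fun _ : 'I_2 => mu))
    measurableT mh (fun q _ => h0 q)).
apply: eq_measure_integral => A mA _.
exact: (@prodP_pair _ T R 2 (fun=> mu) ord0 ord_max).
Qed.

Lemma integral_sqr_sub_mean d (T : measurableType d) (R : realType)
    (mu : probability T R) (g : T -> R) (c : R) :
  measurable_fun setT g -> (forall x, (0 <= g x <= 1)%R) -> (0 <= c)%R ->
  \int[mu]_x (g x)%:E = c%:E ->
  \int[mu]_x (g x ^+ 2)%:E = \int[mu]_x ((g x - c) ^+ 2)%:E + (c ^+ 2)%:E.
Proof.
move=> mg g01 c0 gc.
have g0 x : (0 <= g x)%R by case/andP: (g01 x).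
have mg2 : measurable_fun setT (fun x => (g x ^+ 2)%R) by exact: measurable_funX.
have mgc2 : measurable_fun setT (fun x => ((g x - c) ^+ 2)%R).
  by apply: measurable_funX; apply: measurable_funB => //; exact: measurable_cst.
(* Written as [g^2 + c^2 = (g - c)^2 + 2 c g], all terms are nonnegative and integrals add up
   without integrability conditions. *)
have: \int[mu]_x ((g x ^+ 2)%:E + (c ^+ 2)%:E) =
      \int[mu]_x (((g x - c) ^+ 2)%:E + (2 * c)%:E * (g x)%:E).
  apply: eq_integral => x _; rewrite -EFinM -!EFinD; congr EFin.
  by rewrite sqrrB; ring.
rewrite ge0_integralD//=; last 3 first.
- by move=> x _; rewrite lee_fin sqr_ge0.
- exact/measurable_EFinP.
- by move=> x _; rewrite lee_fin sqr_ge0.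
rewrite ge0_integralD//=; last 4 first.
- by move=> x _; rewrite lee_fin sqr_ge0.
- exact/measurable_EFinP.
- by move=> x _; rewrite mule_ge0 ?lee_fin// mulr_ge0.
- by apply: emeasurable_funM => //; exact/measurable_EFinP.
rewrite ge0_integralZl//=; last 3 first.
- exact/measurable_EFinP.
- by move=> x _; rewrite lee_fin.
- by rewrite lee_fin mulr_ge0.
rewrite gc integral_probability_cst -EFinM => E.
have := congr1 (fun t => t - (c ^+ 2)%:E) E; rewrite addeK// => ->.
by rewrite -addeA -EFinN -EFinD; congr (_ + _%:E); ring.
Qed.

End integral_tools.

(** * The four-cycle inequality *)

Section entry_cdf.
Variable R : realType.
Local Notation Omega := (unitI R).

Definition ray (z : Omega) : set Omega := [set w | valI w < valI z].

Lemma measurable_ray_unitI z : measurable (ray z).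
Proof. exact: measurable_ray. Qed.

Lemma valI01 (z : Omega) : 0 <= valI z <= 1.
Proof.
have : `[0, 1]%classic (valI z) by rewrite -range_valI; exists z.
by rewrite /= in_itv.
Qed.

Lemma valI_onto (x : R) : 0 <= x <= 1 -> exists w : Omega, valI w = x.
Proof.
move=> x01; have : `[0, 1]%classic x by rewrite /= in_itv.
by rewrite -range_valI => -[w _ wx]; exists w.
Qed.

Lemma lam_ray z : lam R (ray z) = (valI z)%:E.
Proof.
rewrite /lam /= /lebI (_ : @valI R @` ray z = `[0, valI z[%classic); last first.
  apply/seteqP; split => [_ [w wz <-]|y /=]; rewrite /= in_itv/=.
    by have /andP[-> _] := valI01 w.
  move=> /andP[y0 yz].
  have [|w wy] := @valI_onto y.
    by rewrite y0/=; have /andP[_] := valI01 z; apply: le_trans; exact: ltW.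
  by exists w; rewrite // /ray /= wy.
have /andP[z0 _] := valI01 z.
rewrite lebesgue_measure_itv/= lte_fin; case: ltP => [_|z0'];
  first by rewrite oppr0 adde0.
by congr EFin; apply/eqP; rewrite eq_le z0 z0'.
Qed.

(* With the numbering [positions] below, sample 0 is the entry in row 0 and column 0,
   samples 1 to 4 form the block in columns 1 and 2, and sample 5 is unconstrained. *)
Definition dominated_event : set (6.-tuple Omega) :=
  [set v | forall i : 'I_5, (i < 4)%N -> valI (tnth v (lift ord0 i)) < valI (tnth v
    ord0)].

Lemma measurable_dominated_event : measurable dominated_event.
Proof.
rewrite (_ : dominated_event = \bigcap_(i in [set i : 'I_5 | (i < 4)%N])
    [set v : 6.-tuple Omega | valI (tnth v (lift ord0 i)) < valI (tnth v ord0)]);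
      last first.
  by apply/seteqP; split => v vD i; exact: vD.
have mv i : measurable_fun setT (fun v : 6.-tuple Omega => valI (tnth v i)).
  by apply: measurableT_comp; [exact: measurable_valI|exact: measurable_tnth].
apply: fin_bigcap_measurable; first exact: finite_finset.
by move=> i _; apply: measurable_ltr_set; exact: mv.
Qed.

(** Given that sample 0 equals [z], the four comparisons are independent, each with probability the
    mass of [ray z]. *)
Lemma prodP_dominated_event (P : 'I_6 -> probability Omega R) :
  prodP P dominated_event = (\int[P ord0]_z
    (\prod_(i < 4) fine (P (lift ord0 (widen_ord (leqnSn 4) i)) (ray z)))%:E)%E.
Proof.
rewrite -[LHS]/(\int[P ord0]_z prodP (fun i => P (lift ord0 i))
  (xsection (@cons_pair _ Omega 5 @^-1` dominated_event) z))%E.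
apply: eq_integral => z _.
rewrite (_ : xsection _ z = box (fun i : 'I_5 => if (i < 4)%N then ray z else setT));
  last first.
  apply/seteqP; split => v.
    move/xsectionP => vD i; case: ifP => // i4.
    by have := vD i i4; rewrite tnthS.
  move=> vB; apply/xsectionP => i i4; have := vB i; rewrite i4.
  by rewrite /cons_pair tnthS.
rewrite prodP_box; last by move=> i; case: ifP => // _; exact: measurable_ray_unitI.
(* The last factor belongs to the unconstrained sample 5. *)
rewrite big_ord_recr /= probability_setT mulr1; congr EFin.
by apply: eq_bigr => i _; rewrite ltn_ord.
Qed.

Lemma lam_dominated_event :
  prodP (fun _ : 'I_6 => lam R) dominated_event = (\int[lam R]_z ((valI z) ^+ 4)%:E)%E.
Proof.
rewrite prodP_dominated_event; apply: eq_integral => z _; congr EFin.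
under eq_bigr => i _ do rewrite lam_ray.
by rewrite prodr_const card_ord.
Qed.

Definition positions (i : 'I_6) : 'I_2 * 'I_3 :=
  nth (ord0, ord0)
    [:: (ord0, ord0); (ord0, lift ord0 ord0); (ord0, ord_max);
        (ord_max, lift ord0 ord0); (ord_max, ord_max); (ord_max, ord0)] i.

Lemma positions_bij : bijective positions.
Proof.
apply: inj_card_bij; last by rewrite card_prod !card_ord.
by case=> [[|[|[|[|[|[|]]]]]] ?] // [[|[|[|[|[|[|]]]]]] ?] //= ; move=> _; apply: val_inj.
Qed.

Variable W : Omega * Omega -> probability Omega R.
Hypothesis kW : is_kernel W.

Definition entry_cdf (z : Omega) (p : Omega * Omega) : R := fine (W p (ray z)).

Lemma entry_cdfE z p : (entry_cdf z p)%:E = W p (ray z).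
Proof. by rewrite /entry_cdf fineK// fin_num_measure//; exact: measurable_ray_unitI. Qed.

Lemma entry_cdf01 z p : 0 <= entry_cdf z p <= 1.
Proof.
rewrite -!lee_fin entry_cdfE measure_ge0 probability_le1//; exact: measurable_ray_unitI.
Qed.

Lemma measurable_entry_cdf :
  measurable_fun setT (fun zp : Omega * (Omega * Omega) => entry_cdf zp.1 zp.2).
Proof.
apply/measurable_EFinP.
pose D := [set p : Omega * Omega | valI p.2 < valI p.1].
have mD : measurable D.
  by apply: measurable_ltr_set; apply: measurableT_comp => //; exact: measurable_valI.
apply: (eq_measurable_fun (fun zp : Omega * (Omega * Omega) => W zp.2 (xsection D zp.1))).
  move=> [z p] _; rewrite /= entry_cdfE; congr (W p _).
  by apply/seteqP; split => w; [move/xsectionP|move=> wz; exact/xsectionP].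
exact: measurable_kernel_xsection.
Qed.

Lemma entries_law_dominated_event (p : 2.-tuple Omega * 3.-tuple Omega) :
  entries_law W positions p dominated_event =
  (\int[W (tnth p.1 ord0, tnth p.2 ord0)]_z
    ((entry_cdf z (tnth p.1 ord0, tnth p.2 (lift ord0 ord0)) *
      entry_cdf z (tnth p.1 ord0, tnth p.2 ord_max)) *
     (entry_cdf z (tnth p.1 ord_max, tnth p.2 (lift ord0 ord0)) *
      entry_cdf z (tnth p.1 ord_max, tnth p.2 ord_max)))%:E)%E.
Proof.
rewrite /entries_law prodP_dominated_event; apply: eq_integral => z _; congr EFin.
by rewrite !big_ord_recl big_ord0 mulr1 mulrA.
Qed.

End entry_cdf.

Section mixture.
Context d1 d2 (T1 : measurableType d1) (T2 : measurableType d2) (R : realType).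
Local Open Scope ereal_scope.

Lemma integral_prod_mul (m1 : probability T1 R) (m2 : probability T2 R)
    (a : T1 -> R) (b : T2 -> R) :
  measurable_fun setT a -> measurable_fun setT b ->
  (forall x, (0 <= a x)%R) -> (forall y, (0 <= b y)%R) ->
  \int[m1 \x m2]_p (a p.1 * b p.2)%:E = \int[m1]_x (a x)%:E * \int[m2]_y (b y)%:E.
Proof.
move=> ma mb a0 b0.
rewrite (fubini_tonelli1 (fun p : T1 * T2 => (a p.1 * b p.2)%:E)); last 2 first.
- apply/measurable_EFinP; apply: measurable_funM.
    exact: (measurableT_comp ma measurable_fst).
  exact: (measurableT_comp mb measurable_snd).
- by move=> p; rewrite lee_fin mulr_ge0.
transitivity (\int[m1]_x ((a x)%:E * \int[m2]_y (b y)%:E)).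
  apply: eq_integral => x _; rewrite -ge0_integralZl//=.
  - exact/measurable_EFinP.
  - by move=> y _; rewrite lee_fin.
  - by rewrite lee_fin.
rewrite ge0_integralZr//=.
- exact/measurable_EFinP.
- by move=> x _; rewrite lee_fin.
- by apply: integral_ge0 => y _; rewrite lee_fin.
Qed.

Lemma product_measure_sections (m1 : probability T1 R) (m2 : probability T2 R) D :
  measurable D ->
  \int[m1]_x m2 (xsection D x) = \int[m2]_y m1 (ysection D y).
Proof.
move=> mD; rewrite -[LHS]/((m1 \x m2) D) -[RHS]/((m1 \x^ m2) D).
by apply: product_measure_unique => // A B mA mB; exact: product_measure2E.
Qed.

End mixture.

Section layer_cake.
Variable R : realType.
Local Notation Omega := (unitI R).
Local Open Scope ereal_scope.

(** With [K] a row of [W], this makes the threshold entry uniform once its column is averaged out.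
    The regularity hypothesis speaks of sets only; values of [h] in the unit interval allow the
    passage to functions. *)
Lemma integral_mixture (K : Omega -> probability Omega R) (h : Omega -> R) :
  is_kernel K ->
  (forall S, measurable S -> \int[lam R]_y K y S = lam R S) ->
  measurable_fun setT h -> (forall z, (0 <= h z <= 1)%R) ->
  \int[lam R]_y \int[K y]_z (h z)%:E = \int[lam R]_z (h z)%:E.
Proof.
move=> kK Kmix mh h01.
pose D := [set p : Omega * Omega | (valI p.1 < h p.2)%R].
have mD : measurable D.
  apply: measurable_ltr_set.
    by apply: measurableT_comp => //; exact: measurable_valI.
  exact: measurableT_comp.
(* Layer-cake formula: [h z] is the [lam]-measure of the [t] below it. *)
have hE (m : probability Omega R) : \int[m]_z (h z)%:E = \int[lam R]_t m (xsection D t).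
  rewrite product_measure_sections//; apply: eq_integral => z _.
  have [w wh] := valI_onto (h01 z).
  rewrite -wh -lam_ray; congr (lam R _).
  by apply/seteqP; split => t; [rewrite /ray /= wh => th; exact/ysectionP|
    move/ysectionP; rewrite /D /ray /= wh].
rewrite hE; under eq_integral => y _ do rewrite hE.
rewrite (fubini_tonelli (fun p : Omega * Omega => K p.1 (xsection D p.2)))//=; last first.
  exact: (measurableT_comp (measurable_kernel_xsection kK mD) (@measurable_swap _ _ _ _)).
by apply: eq_integral => t _; rewrite Kmix//; exact: measurable_xsection.
Qed.

End layer_cake.

Section overlap.
Variable R : realType.
Local Notation Omega := (unitI R).
Local Open Scope ereal_scope.
Variable W : Omega * Omega -> probability Omega R.
Hypothesis kW : is_kernel W.

Let U := entry_cdf W.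
Let U0 z p : (0 <= U z p)%R. Proof. by have /andP[] := entry_cdf01 W z p. Qed.
Let U1 z p : (U z p <= 1)%R. Proof. by have /andP[] := entry_cdf01 W z p. Qed.
Let mU := measurable_entry_cdf kW.

(** The codegree of two rows in the weighted bipartite graph [entry_cdf W z]. The rows come as a
    pair, to be averaged over the product measure. *)
Definition overlap (z : Omega) (x : Omega * Omega) : R :=
  fine (\int[lam R]_y (entry_cdf W z (x.1, y) * entry_cdf W z (x.2, y))%:E).

Let mUU : measurable_fun setT (fun q : (Omega * (Omega * Omega)) * Omega =>
  (U q.1.1 (q.1.2.1, q.2) * U q.1.1 (q.1.2.2, q.2))%R).
Proof.
apply: measurable_funM.
  apply: (measurableT_comp mU (g := fun q : (Omega * (Omega * Omega)) * Omega =>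
    (q.1.1, (q.1.2.1, q.2)))).
  apply: measurable_fun_pair; first by do 2 apply: measurableT_comp => //.
  by apply: measurable_fun_pair => //; do 3 apply: measurableT_comp => //.
apply: (measurableT_comp mU (g := fun q : (Omega * (Omega * Omega)) * Omega =>
  (q.1.1, (q.1.2.2, q.2)))).
apply: measurable_fun_pair; first by do 2 apply: measurableT_comp => //.
by apply: measurable_fun_pair => //; do 3 apply: measurableT_comp => //.
Qed.

Let UU01 z x y : (0 <= U z (x.1, y) * U z (x.2, y) <= 1)%R.
Proof. by rewrite mulr_ge0//= mulr_ile1. Qed.

Lemma overlapE z x :
  (overlap z x)%:E = \int[lam R]_y (entry_cdf W z (x.1, y) * entry_cdf W z (x.2, y))%:E.
Proof.
rewrite /overlap fineK//; apply: (@integral_probability_fin_num _ _ _ _ _ 1).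
- apply/measurable_EFinP.
  exact: (measurableT_comp mUU (pair1_measurable (z, x))).
- by move=> y; rewrite lee_fin; have /andP[] := UU01 z x y.
- by move=> y; rewrite lee_fin; have /andP[] := UU01 z x y.
Qed.

Lemma overlap01 z x : (0 <= overlap z x <= 1)%R.
Proof.
rewrite -!lee_fin overlapE; apply/andP; split.
  by apply: integral_ge0 => y _; rewrite lee_fin; have /andP[] := UU01 z x y.
apply: integral_probability_le.
- apply/measurable_EFinP.
  exact: (measurableT_comp mUU (pair1_measurable (z, x))).
- by move=> y; rewrite lee_fin; have /andP[] := UU01 z x y.
- by move=> y; rewrite lee_fin; have /andP[] := UU01 z x y.
Qed.

Lemma measurable_overlap :
  measurable_fun setT (fun q : Omega * (Omega * Omega) => overlap q.1 q.2).
Proof.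
apply/measurable_EFinP.
rewrite (_ : _ \o _ = fun q => \int[lam R]_y (U q.1 (q.2.1, y) * U q.1 (q.2.2, y))%:E).
  apply: (measurable_fun_fubini_tonelli_F (m2 := lam R)
    (fun q : (Omega * (Omega * Omega)) * Omega =>
      (U q.1.1 (q.1.2.1, q.2) * U q.1.1 (q.1.2.2, q.2))%:E)).
    exact/measurable_EFinP.
  by move=> [[z x] y] /=; rewrite lee_fin mulr_ge0.
by apply/funext => q /=; rewrite overlapE.
Qed.

End overlap.

Section four_cycle.
Variable R : realType.
Local Notation Omega := (unitI R).
Local Open Scope ereal_scope.
Variable W : Omega * Omega -> probability Omega R.
Hypothesis kW : is_kernel W.
Hypothesis row_regular : {ae lam R, forall x, forall S, measurable S ->
  \int[lam R]_y W (x, y) S = lam R S}.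
Hypothesis col_regular : {ae lam R, forall y, forall S, measurable S ->
  \int[lam R]_x W (x, y) S = lam R S}.

Let U := entry_cdf W.
Let U0 z p : (0 <= U z p)%R. Proof. by have /andP[] := entry_cdf01 W z p. Qed.
Let U1 z p : (U z p <= 1)%R. Proof. by have /andP[] := entry_cdf01 W z p. Qed.
Let mU := measurable_entry_cdf kW.

Let lam2 : probability (Omega * Omega)%type R := lam R \x lam R.

Let four z (x v : Omega * Omega) : R :=
  ((U z (x.1, v.1) * U z (x.1, v.2)) * (U z (x.2, v.1) * U z (x.2, v.2)))%R.

Let mfour : measurable_fun setT
  (fun q : Omega * ((Omega * Omega) * (Omega * Omega)) => four q.1 q.2.1 q.2.2).
Proof.
have m1 a b : measurable_fun setT a -> measurable_fun setT b ->
    measurable_fun setT (fun q : Omega * ((Omega * Omega) * (Omega * Omega)) =>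
      U q.1 (a q, b q)).
  move=> ma mb; apply: (measurableT_comp mU (g := fun q : Omega * ((Omega * Omega) *
    (Omega * Omega)) => (q.1, (a q, b q)))).
  by apply: measurable_fun_pair => //; exact: measurable_fun_pair.
by apply: measurable_funM; apply: measurable_funM; apply: m1 => //;
  do 2 apply: measurableT_comp => //.
Qed.

Let four01 z x v : (0 <= four z x v <= 1)%R.
Proof. by rewrite /four !mulr_ge0//= !mulr_ile1// mulr_ge0. Qed.

Let mfour_zv x : measurable_fun setT (fun q : (Omega * Omega) * Omega => four q.2 x q.1).
Proof.
apply: (measurableT_comp mfour (g := fun q : (Omega * Omega) * Omega => (q.2, (x, q.1)))).
by apply: measurable_fun_pair => //; exact: measurable_fun_pair.
Qed.

(** For fixed rows the 4-cycle weight factors over its two columns, which are independent and each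
    contribute one codegree. *)
Let overlap_sqr z x :
  \int[lam2]_v (four z x v)%:E = (overlap W z x ^+ 2)%:E.
Proof.
have mo : measurable_fun setT (fun y => (U z (x.1, y) * U z (x.2, y))%R).
  have m1 a : measurable_fun setT (fun y => U z (a, y)).
    apply: (measurableT_comp mU (g := fun y => (z, (a, y)))).
    by apply: measurable_fun_pair => //; exact: measurable_fun_pair.
  exact: measurable_funM.
rewrite (eq_integral (fun v => ((U z (x.1, v.1) * U z (x.2, v.1)) * (U z (x.1, v.2) * U
  z (x.2, v.2)))%:E)); last first.
  by move=> v _; rewrite /four mulrACA.
rewrite (@integral_prod_mul _ _ _ _ R (lam R) (lam R)
   (fun y => (U z (x.1, y) * U z (x.2, y))%R)
   (fun y => (U z (x.1, y) * U z (x.2, y))%R))//.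
- by rewrite -overlapE// -EFinM expr2.
- by move=> y; rewrite mulr_ge0.
- by move=> y; rewrite mulr_ge0.
Qed.

(** Column 0 enters only through the law of the threshold, as the 4-cycle lives on columns 1 and 2.
    So it can be integrated out first, and regularity of row 0 replaces that law by the uniform
    one. *)
Let integral_entries_law_row (x : 2.-tuple Omega) :
  (forall S, measurable S -> \int[lam R]_y W (tnth x ord0, y) S = lam R S) ->
  \int[prodP (fun _ : 'I_3 => lam R)]_y
     entries_law W positions (x, y) (dominated_event (R := R)) =
  \int[lam R]_z (overlap W z (tnth x ord0, tnth x ord_max) ^+ 2)%:E.
Proof.
move=> xreg; set xx := (tnth x ord0, tnth x ord_max).
pose Phi (y : 3.-tuple Omega) := entries_law W positions (x, y) (dominated_event (R :=
  R)).
have mPhi : measurable_fun setT Phi.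
  have mE := is_kernel_entries_law kW positions (@measurable_dominated_event R).
  exact: (measurableT_comp mE (pair1_measurable x)).
rewrite (@integral_prodP_cons _ _ R 2 _ Phi)//.
have PhiE y0 (v : 2.-tuple Omega) : Phi (cons_pair (y0, v)) =
    \int[W (tnth x ord0, y0)]_z (four z xx (tnth v ord0, tnth v ord_max))%:E.
  rewrite /Phi entries_law_dominated_event; apply: eq_integral => z _.
  rewrite /four/= (_ : ord_max = lift ord0 (ord_max : 'I_2)); last exact: val_inj.
  by rewrite !tnthS.
rewrite (fubini_tonelli (fun q : Omega * 2.-tuple Omega => Phi (cons_pair q)))//;
  last first.
  by apply: measurableT_comp => //; exact: measurable_cons_pair.
(* With the block columns [v] fixed, [integral_mixture] applies to the 4-cycle weight as a function
   of the threshold. *)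
rewrite (eq_integral (fun v : 2.-tuple Omega =>
    \int[lam R]_z (four z xx (tnth v ord0, tnth v ord_max))%:E)); last first.
  move=> v _; under eq_integral => y _ do rewrite PhiE.
  apply: (@integral_mixture R (fun y => W (tnth x ord0, y))) => //.
    apply: is_kernel_comp kW; exact: pair1_measurable.
  apply: (measurableT_comp (mfour_zv xx) (g := fun z =>
    ((tnth v ord0, tnth v ord_max), z))).
  exact: pair1_measurable.
rewrite (@integral_iid_pair _ _ R (lam R) (fun v => \int[lam R]_z (four z xx v)%:E));
  last 2 first.
- apply: (measurable_fun_fubini_tonelli_F (m2 := lam R)
  (fun q : (Omega * Omega) * Omega => (four q.2 xx q.1)%:E)).
    exact/measurable_EFinP.
  by move=> q; rewrite lee_fin; have /andP[] := four01 q.2 xx q.1.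
- by move=> v; apply: integral_ge0 => z _; rewrite lee_fin; have /andP[] := four01 z xx v.
transitivity (\int[lam R]_z \int[lam2]_v (four z xx v)%:E); last first.
  by apply: eq_integral => z _; rewrite overlap_sqr.
apply: (@fubini_tonelli _ _ _ _ R lam2 (lam R)
    (fun q : (Omega * Omega) * Omega => (four q.2 xx q.1)%:E)).
- exact/measurable_EFinP.
- by move=> q; rewrite lee_fin; have /andP[] := four01 q.2 xx q.1.
Qed.

Lemma integral_dominated_event :
  \int[points_law R 2 3]_p entries_law W positions p (dominated_event (R := R)) =
  \int[lam R]_z \int[lam R \x lam R]_x (overlap W z x ^+ 2)%:E.
Proof.
have mD := @measurable_dominated_event R.
have mE := is_kernel_entries_law kW positions mD.
have mo2 : measurable_fun setT (fun q : (Omega * Omega) * Omega =>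
  (overlap W q.2 q.1 ^+ 2)%:E).
  apply/measurable_EFinP; apply: measurable_funX.
  apply: (measurableT_comp (measurable_overlap kW) 
    (g := fun q : (Omega * Omega) * Omega => (q.2, q.1))).
  exact: measurable_fun_pair.
pose H (x : Omega * Omega) := \int[lam R]_z (overlap W z x ^+ 2)%:E.
have H0 x : 0 <= H x by apply: integral_ge0 => z _; rewrite lee_fin sqr_ge0.
have mH : measurable_fun setT H.
  apply: (measurable_fun_fubini_tonelli_F (m2 := lam R)
    (fun q : (Omega * Omega) * Omega => (overlap W q.2 q.1 ^+ 2)%:E)) => //.
  by move=> q; rewrite lee_fin sqr_ge0.
rewrite integral_points_law//.
transitivity (\int[prodP (fun _ : 'I_2 => lam R)]_x H (tnth x ord0, tnth x ord_max)).
  apply: ge0_ae_eq_integral; [exact: measurableT| | |by move=> x _;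
    exact: integral_ge0|by []|].
  - exact: (measurable_fun_fubini_tonelli_F (m2 := prodP (fun _ : 'I_3 => lam R))
      (fun p => entries_law W positions p (dominated_event (R := R)))).
  - apply: (measurableT_comp mH (g := fun x : 2.-tuple Omega =>
    (tnth x ord0, tnth x ord_max))).
    by apply: measurable_fun_pair; exact: measurable_tnth.
  (* The exceptional rows stay negligible for the pair of rows, since its first coordinate has law
     [lam R]. *)
  have [N [mN N0 rN]] := row_regular.
  exists [set x | N (tnth x ord0)]; split.
  - by rewrite -[X in measurable X]setTI; exact: measurable_tnth.
  - exact: etrans (prodP_tnth _ _ mN) N0.
  - move=> x xbad; apply: rN => xreg; apply: xbad => _.
    by rewrite (integral_entries_law_row xreg).
rewrite (@integral_iid_pair _ _ R (lam R) H)//.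
apply: (@fubini_tonelli _ _ _ _ R lam2 (lam R)
    (fun q : (Omega * Omega) * Omega => (overlap W q.2 q.1 ^+ 2)%:E)) => //.
by move=> q; rewrite lee_fin sqr_ge0.
Qed.

End four_cycle.

(** * Constant codegrees *)

Section vanishing.
Context d (T : measurableType d) (R : realType) (mu : probability T R).
Local Open Scope ereal_scope.

Lemma ge0_integral0_ae (g : T -> \bar R) :
  measurable_fun setT g -> (forall x, 0 <= g x) -> \int[mu]_x g x = 0 ->
  {ae mu, forall x, g x = 0}.
Proof.
move=> mg g0 ig.
have /(ae_eq_integral_abs mu measurableT mg) : \int[mu]_x `|g x| = 0.
  by rewrite -[RHS]ig; apply: eq_integral => x _; rewrite gee0_abs.
by apply: filterS => x /(_ I).
Qed.

Lemma integral_sqr_sub0_ae (g : T -> R) (c : R) : measurable_fun setT g ->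
  \int[mu]_x ((g x - c) ^+ 2)%:E = 0 -> {ae mu, forall x, g x = c}.
Proof.
move=> mg /ge0_integral0_ae H.
have : {ae mu, forall x, ((g x - c) ^+ 2)%:E = 0}.
  apply: H => [|x]; last by rewrite lee_fin sqr_ge0.
  by apply/measurable_EFinP/measurable_funX/measurable_funB.
apply: filterS => x [] /eqP; by rewrite sqrf_eq0 subr_eq0 => /eqP.
Qed.

End vanishing.

Section codegree.
Context d1 d2 (T1 : measurableType d1) (T2 : measurableType d2) (R : realType).
Variables (mu : probability T1 R) (nu : probability T2 R) (u : T1 * T2 -> R) (c : R).
Local Open Scope ereal_scope.

Let mu2 : probability (T1 * T1)%type R := mu \x mu.
Let munu : probability (T1 * T2)%type R := mu \x nu.

Hypotheses (mu_ : measurable_fun setT u) (u01 : forall p, (0 <= u p <= 1)%R)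
  (c0 : (0 <= c)%R).
Hypothesis row : {ae mu, forall x, \int[nu]_y (u (x, y))%:E = c%:E}.
Hypothesis codegree : {ae mu2, forall x,
  \int[nu]_y (u (x.1, y) * u (x.2, y))%:E = (c ^+ 2)%:E}.

Let u0 p : (0 <= u p)%R. Proof. by have /andP[] := u01 p. Qed.

Section set.
Variable A : set T1.
Hypothesis mA : measurable A.

Let v (p : T1 * T2) : R := (\1_A p.1 * u p)%R.

Let a : R := fine (mu A).

Let aE : a%:E = mu A. Proof. by rewrite /a fineK// fin_num_measure. Qed.

Let mi : measurable_fun setT (\1_A : T1 -> R).
Proof. exact: measurable_indic. Qed.

Let integral_indicA : \int[mu]_x (\1_A x)%:E = mu A.
Proof. by rewrite integral_indic// setIT. Qed.

Let mv : measurable_fun setT v.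
Proof. by apply: measurable_funM => //; exact: (measurableT_comp mi measurable_fst). Qed.

Let v01 p : (0 <= v p <= 1)%R.
Proof.
rewrite /v indicE; have /andP[? ?] := u01 p.
by case: (_ \in _); rewrite ?mul1r ?mul0r ?lexx ?ler01//; apply/andP.
Qed.

Let v0 p : (0 <= v p)%R. Proof. by have /andP[] := v01 p. Qed.

(** The degree of column [y] into the row set [A]. *)
Let h (y : T2) : R := fine (\int[mu]_x (v (x, y))%:E).

Let hE y : (h y)%:E = \int[mu]_x (v (x, y))%:E.
Proof.
rewrite /h fineK//; apply: (@integral_probability_fin_num _ _ _ _ _ 1) => [|x|x].
- apply/measurable_EFinP; exact: (measurableT_comp mv (pair2_measurable y)).
- by rewrite lee_fin.
- by rewrite lee_fin; have /andP[] := v01 (x, y).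
Qed.

Let h01 y : (0 <= h y <= 1)%R.
Proof.
rewrite -!lee_fin hE; apply/andP; split; first by apply: integral_ge0 => x _;
  rewrite lee_fin.
apply: integral_probability_le => [|x|x].
- apply/measurable_EFinP; exact: (measurableT_comp mv (pair2_measurable y)).
- by rewrite lee_fin.
- by rewrite lee_fin; have /andP[] := v01 (x, y).
Qed.

Let mh : measurable_fun setT h.
Proof.
apply/measurable_EFinP.
rewrite (_ : _ \o _ = fun y => \int[mu]_x (v (x, y))%:E); last by apply/funext => y;
  rewrite -hE.
apply: (measurable_fun_fubini_tonelli_G (m1 := mu) (fun p => (v p)%:E)).
  exact/measurable_EFinP.
by move=> p; rewrite lee_fin.
Qed.

(** Double counting: each row of [A] contributes its degree [c]. *)
Let integral_h : \int[nu]_y (h y)%:E = (c * a)%:E.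
Proof.
under eq_integral => y _ do rewrite hE.
rewrite -(fubini_tonelli (m1 := mu) (m2 := nu) (fun p => (v p)%:E)); last 2 first.
- exact/measurable_EFinP.
- by move=> p; rewrite lee_fin.
transitivity (\int[mu]_x (c%:E * (\1_A x)%:E)).
  apply: ge0_ae_eq_integral => //.
  - apply: (measurable_fun_fubini_tonelli_F (m2 := nu) (fun p => (v p)%:E)).
      exact/measurable_EFinP.
    by move=> p; rewrite lee_fin.
  - by apply: emeasurable_funM => //; exact/measurable_EFinP.
  - by move=> x _; apply: integral_ge0 => y _; rewrite lee_fin.
  - by move=> x _; rewrite -EFinM lee_fin mulr_ge0.
  move: row; apply: filterS => x xc _.
  rewrite muleC -xc -ge0_integralZl//.
  - by apply/measurable_EFinP; exact: (measurableT_comp mu_ (pair1_measurable x)).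
  - by move=> y _; rewrite lee_fin.
rewrite ge0_integralZl//.
- by rewrite integral_indicA -aE -EFinM.
- exact/measurable_EFinP.
Qed.

(** The square of [h] is an integral over pairs of rows of [A]; exchanging it with the integral over
    [y] produces codegrees, almost all equal to [c ^+ 2]. With [integral_h], the variance of [h]
    vanishes. *)
Let integral_h2 : \int[nu]_y (h y ^+ 2)%:E = ((c * a) ^+ 2)%:E.
Proof.
pose w (q : (T1 * T1) * T2) := (v (q.1.1, q.2) * v (q.1.2, q.2))%R.
have mw : measurable_fun setT w.
  apply: measurable_funM.
    apply: (measurableT_comp mv (g := fun q : (T1 * T1) * T2 => (q.1.1, q.2))).
    by apply: measurable_fun_pair => //; exact: measurableT_comp.
  apply: (measurableT_comp mv (g := fun q : (T1 * T1) * T2 => (q.1.2, q.2))).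
  by apply: measurable_fun_pair => //; exact: measurableT_comp.
have w0 q : (0 <= w q)%R by rewrite mulr_ge0.
transitivity (\int[nu]_y \int[mu2]_x (w (x, y))%:E).
  apply: eq_integral => y _.
  have mvy : measurable_fun setT (fun x => v (x, y)).
    exact: (measurableT_comp mv (pair2_measurable y)).
  rewrite (@integral_prod_mul _ _ _ _ R mu mu (fun x => v (x, y)) (fun x => v (x, y)))//.
  by rewrite -hE -EFinM expr2.
rewrite -(@fubini_tonelli _ _ _ _ R mu2 nu (fun q => (w q)%:E)); last 2 first.
- exact/measurable_EFinP.
- by move=> q; rewrite lee_fin.
transitivity (\int[mu2]_x ((c ^+ 2)%:E * (\1_A x.1 * \1_A x.2)%:E)).
  have mii : measurable_fun setT (fun x : T1 * T1 => (\1_A x.1 * \1_A x.2)%:E : \bar R).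
    apply/measurable_EFinP; apply: measurable_funM.
      exact: (measurableT_comp mi measurable_fst).
    exact: (measurableT_comp mi measurable_snd).
  apply: ge0_ae_eq_integral => //.
  - apply: (measurable_fun_fubini_tonelli_F (m2 := nu) (fun q => (w q)%:E)).
      exact/measurable_EFinP.
    by move=> q; rewrite lee_fin.
  - exact: emeasurable_funM.
  - by move=> x _; apply: integral_ge0 => y _; rewrite lee_fin.
  - by move=> x _; rewrite -EFinM lee_fin mulr_ge0 ?sqr_ge0// mulr_ge0.
  move: codegree; apply: filterS => x xc _.
  rewrite muleC -xc -ge0_integralZl//.
  - by apply: eq_integral => y _; rewrite -EFinM /w /v/= mulrACA.
  - apply/measurable_EFinP; apply: measurable_funM.
      exact: (measurableT_comp mu_ (pair1_measurable x.1)).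
    exact: (measurableT_comp mu_ (pair1_measurable x.2)).
  - by move=> y _; rewrite lee_fin mulr_ge0.
rewrite ge0_integralZl//.
- rewrite (@integral_prod_mul _ _ _ _ R mu mu \1_A \1_A)//.
  by rewrite integral_indicA -aE -!EFinM exprMn.
- apply/measurable_EFinP; apply: measurable_funM.
    exact: (measurableT_comp mi measurable_fst).
  exact: (measurableT_comp mi measurable_snd).
- by rewrite lee_fin sqr_ge0.
Qed.

Let ca0 : (0 <= c * a)%R.
Proof. by rewrite mulr_ge0// -lee_fin aE. Qed.

Let h_ae : {ae nu, forall y, h y = (c * a)%R}.
Proof.
apply: integral_sqr_sub0_ae => //.
have := integral_sqr_sub_mean mh h01 ca0 integral_h; rewrite integral_h2.
move=> /(congr1 (fun t => t - ((c * a) ^+ 2)%:E)).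
by rewrite subee// addeK.
Qed.

(** Integrating over the rows of [A] first leaves [h], which is almost everywhere [c * a]. *)
Lemma integral_rectangle B : measurable B ->
  \int[munu]_(p in A `*` B) (u p)%:E = c%:E * munu (A `*` B).
Proof.
move=> mB.
pose b (q : T1 * T2) : R := (v q * \1_B q.2)%R.
have miB : measurable_fun setT (\1_B : T2 -> R) by exact: measurable_indic.
have mb : measurable_fun setT b.
  by apply: measurable_funM => //; exact: (measurableT_comp miB measurable_snd).
transitivity (\int[munu]_p (b p)%:E).
  rewrite integral_mkcond; apply: eq_integral => -[x y] _.
  rewrite patchE /b /v !indicE in_setX /=.
  by case: (x \in A); case: (y \in B); rewrite /= ?(mul1r, mul0r, mulr1, mulr0).
transitivity (\int[nu]_y \int[mu]_x (b (x, y))%:E).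
  apply: (@fubini_tonelli2 _ _ _ _ R mu nu (fun p => (b p)%:E)).
    exact/measurable_EFinP.
  by move=> p; rewrite lee_fin mulr_ge0.
transitivity (\int[nu]_y ((c * a)%:E * (\1_B y)%:E)).
  apply: ge0_ae_eq_integral => //.
  - apply: (measurable_fun_fubini_tonelli_G (m1 := mu) (fun p => (b p)%:E)).
      exact/measurable_EFinP.
    by move=> p; rewrite lee_fin mulr_ge0.
  - by apply: emeasurable_funM => //; exact/measurable_EFinP.
  - by move=> y _; apply: integral_ge0 => x _; rewrite lee_fin mulr_ge0.
  - by move=> y _; rewrite -EFinM lee_fin mulr_ge0.
  move: h_ae; apply: filterS => y hy _; rewrite -hy hE -ge0_integralZr//.
  - by apply/measurable_EFinP; exact: (measurableT_comp mv (pair2_measurable y)).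
  - by move=> x _; rewrite lee_fin.
rewrite ge0_integralZl//; last exact/measurable_EFinP.
rewrite integral_indic// setIT EFinM aE -muleA; congr (_ * _).
by apply/esym; exact: product_measure1E.
Qed.

End set.
(** Rectangles form an intersection-stable generating family, so agreement of integrals on them
    extends to all measurable sets and determines the density. *)
Lemma codegree_const_ae : {ae munu, forall p, u p = c}.
Proof.
have mue : measurable_fun setT (EFin \o u) by exact/measurable_EFinP.
have iu : munu.-integrable setT (EFin \o u).
  apply/integrableP; split => //.
  apply: (@le_lt_trans _ _ 1); last exact: ltry.
  apply: integral_probability_le => [|p|p]; first exact: measurableT_comp.
    exact: abse_ge0.
  by rewrite /= lee_fin ger0_norm//; have /andP[] := u01 p.
(* [m1] has density [u] with respect to [munu]; it is to be identified with [c] times [munu]. *)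
pose m1 E := \int[munu]_(p in E) (u p)%:E.
have m1_0 : m1 set0 = 0 by exact: integral_set0.
have m1_ge0 E : 0 <= m1 E by apply: integral_ge0 => p _; rewrite lee_fin.
have m1_sa : semi_sigma_additive m1.
  by apply: semi_sigma_additive_nng_induced => // p; rewrite lee_fin.
pose m1' : {measure set (T1 * T2) -> \bar R} :=
  HB.pack m1 (isMeasure.Build _ _ _ m1 m1_0 m1_ge0 m1_sa).
pose m2 := mscale (NngNum c0) munu.
have m12 E : measurable E -> m1' E = m2 E.
  move=> mE.
  apply: (measure_unique [set A `*` B | A in measurable & B in measurable]
    (fun=> setT)) => //.
  - by rewrite measurable_prod_measurableType.
  - move=> _ _ [A1 mA1 [A2 mA2 <-]] [B1 mB1 [B2 mB2 <-]].
    exists (A1 `&` B1); first exact: measurableI.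
    exists (A2 `&` B2); first exact: measurableI.
    by rewrite setXI.
  - by move=> _; exists setT => //; exists setT => //; rewrite setXTT.
  - by rewrite bigcup_const//; exists 0%N.
  - by move=> _ [A mA [B mB <-]]; exact: integral_rectangle.
  - move=> _; apply: (@le_lt_trans _ _ 1); last exact: ltry.
    apply: integral_probability_le => [//|p|p]; first by rewrite lee_fin.
    by rewrite lee_fin; have /andP[] := u01 p.
have : ae_eq munu setT (EFin \o u) (cst c%:E).
  apply: integral_ae_eq => // E _ mE.
  by rewrite integral_cst//; exact: m12.
by apply: filterS => p /(_ I)[].
Qed.

End codegree.

(** * Proof of the theorem *)

Section uniform_law.
Variable R : realType.
Local Notation Omega := (unitI R).

Lemma lam_itv (a b : R) : 0 <= a -> a < b -> b <= 1 ->
  lam R [set z | a < valI z < b] = (b - a)%:E.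
Proof.
move=> a0 ab b1; rewrite /lam /= /lebI (_ : @valI R @` _ = `]a, b[%classic).
  by rewrite lebesgue_measure_itv/= lte_fin ab.
apply/seteqP; split => [_ [w wab <-]|y /=]; rewrite /= in_itv//= => /andP[ay yb].
have [|w wy] := @valI_onto R y; last by exists w; rewrite //= wy ay.
by rewrite (le_trans a0 (ltW ay)) (le_trans (ltW yb)).
Qed.

(** Full measure makes the good thresholds dense, and a monotone distribution function is squeezed
    between its values at nearby good thresholds. *)
Lemma probability_lam_unique (m : probability Omega R) :
  {ae lam R, forall z, m (ray z) = (valI z)%:E} ->
  forall S, measurable S -> m S = lam R S.
Proof.
move=> [N [mN N0 mrN]]; apply: unitI_probability_unique => c.
(* An interval without good thresholds would lie in the null set [N], against its positive
   length. *)
have good a b : 0 <= a -> a < b -> b <= 1 ->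
    exists2 z : Omega, a < valI z < b & m (ray z) = (valI z)%:E.
  move=> a0 ab b1; apply: contrapT => noz.
  have : (lam R [set z : Omega | (a < valI z < b)%R] <= lam R N)%E.
    apply: le_measure; rewrite ?inE//.
      rewrite (_ : [set z | _] = [set z | a < valI z] `&` [set z | valI z < b]).
        apply: measurableI; last exact: measurable_ray.
        by apply: measurable_ltr_set; [exact: measurable_cst|exact: measurable_valI].
      by apply/seteqP; split => z /= => [/andP|[-> ->]].
    by move=> z zab; apply: mrN => mz; apply: noz; exists z.
  by rewrite lam_itv// N0 lee_fin leNgt subr_gt0 ab.
have mono (z : Omega) (d : R) : valI z <= d -> (m (ray z) <= m [set x | (valI x <
  d)%R])%E.
  move=> zd; apply: le_measure; rewrite ?inE;
    [exact: measurable_ray|exact: measurable_ray|].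
  by move=> x /= /lt_le_trans; exact.
have mono' (z : Omega) (d : R) : d <= valI z -> (m [set x | (valI x < d)%R] <= m (ray
  z))%E.
  move=> zd; apply: le_measure; rewrite ?inE;
    [exact: measurable_ray|exact: measurable_ray|].
  by move=> x /= /lt_le_trans; exact.
case: (leP c 0) => [c0|c0].
  rewrite (_ : [set x | _] = set0) ?measure0//.
  apply/seteqP; split => // x /= /lt_le_trans/(_ c0).
  by rewrite ltNge; have /andP[-> _] := valI01 x.
case: (ltP 1 c) => [c1|c1].
  rewrite (_ : [set x | _] = setT) ?probability_setT//.
  by apply/seteqP; split => // x _ /=; apply: le_lt_trans c1; have /andP[] := valI01 x.
have [|w wc] := @valI_onto R c; first by rewrite (ltW c0).
have -> : [set x : Omega | valI x < c] = ray w by rewrite -wc.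
rewrite lam_ray wc; apply/eqP; rewrite eq_le; apply/andP; split.
  (* No threshold lies to the right of 1, but there the upper bound is that of a probability. *)
  have [->|c_neq1] := eqVneq c 1.
    exact: (probability_le1 m (measurable_ray_unitI w)).
  apply/lee_addgt0Pr => e e0.
  (* Cutting at 1, and below at 0, keeps the search for a good threshold inside the unit
     interval. *)
  have [||z /andP[cz ze] mz] := good c (Num.min (c + e) 1) (ltW c0).
  - by rewrite lt_min ltrDl e0 lt_neqAle c_neq1.
  - by rewrite ge_min lexx orbT.
  rewrite -wc; apply: (le_trans (@mono' z (valI w) _)); first by rewrite wc ltW.
  rewrite mz -EFinD lee_fin wc ltW//; apply: (lt_le_trans ze); by rewrite ge_min lexx.
apply/lee_subgt0Pr => e e0.
have [|||z /andP[cz ze] mz] := good (Num.max (c - e) 0) c.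
- by rewrite le_max lexx orbT.
- by rewrite gt_max c0 andbT ltrBlDr ltrDl.
- exact: c1.
apply: (le_trans _ (@mono z (valI w) _)); last by rewrite wc ltW.
rewrite mz -EFinB lee_fin ltW//; apply: le_lt_trans cz; by rewrite le_max lexx.
Qed.

End uniform_law.

Section uniformity.
Variable R : realType.
Local Notation Omega := (unitI R).
Local Open Scope ereal_scope.
Variable W : Omega * Omega -> probability Omega R.
Hypothesis kW : is_kernel W.
Hypothesis row_regular : {ae lam R, forall x, forall S, measurable S ->
  \int[lam R]_y W (x, y) S = lam R S}.
Hypothesis col_regular : {ae lam R, forall y, forall S, measurable S ->
  \int[lam R]_x W (x, y) S = lam R S}.

Let lam2 : probability (Omega * Omega)%type R := lam R \x lam R.

Let U0 z p : (0 <= entry_cdf W z p)%R.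
Proof. by have /andP[] := entry_cdf01 W z p. Qed.

Let mUz z : measurable_fun setT (entry_cdf W z).
Proof. exact: (measurableT_comp (measurable_entry_cdf kW) (pair1_measurable z)). Qed.

Let valI0 (z : Omega) : (0 <= valI z)%R.
Proof. by have /andP[] := valI01 z. Qed.

Let moz z : measurable_fun setT (overlap W z).
Proof. exact: (measurableT_comp (measurable_overlap kW) (pair1_measurable z)). Qed.

Let row_mean z : {ae lam R, forall x, \int[lam R]_y (entry_cdf W z (x, y))%:E = (valI
  z)%:E}.
Proof.
move: row_regular; apply: filterS => x xreg.
rewrite -lam_ray -xreg; last exact: measurable_ray_unitI.
by apply: eq_integral => y _; rewrite entry_cdfE.
Qed.

Let col_mean z : {ae lam R, forall y, \int[lam R]_x (entry_cdf W z (x, y))%:E = (valI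
  z)%:E}.
Proof.
move: col_regular; apply: filterS => y yreg.
rewrite -lam_ray -yreg; last exact: measurable_ray_unitI.
by apply: eq_integral => x _; rewrite entry_cdfE.
Qed.

(** For fixed [y] the two rows are independent, and each averages to the degree of column [y]; this
    is where regularity of the columns enters. *)
Lemma integral_overlap z :
  \int[lam R \x lam R]_x (overlap W z x)%:E = ((valI z) ^+ 2)%:E.
Proof.
pose w (q : (Omega * Omega) * Omega) :=
  (entry_cdf W z (q.1.1, q.2) * entry_cdf W z (q.1.2, q.2))%R.
have mw : measurable_fun setT w.
  apply: measurable_funM.
    apply: (measurableT_comp (mUz z) (g := fun q : (Omega * Omega) * Omega =>
      (q.1.1, q.2))).
    by apply: measurable_fun_pair => //; exact: measurableT_comp.
  apply: (measurableT_comp (mUz z) (g := fun q : (Omega * Omega) * Omega =>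
    (q.1.2, q.2))).
  by apply: measurable_fun_pair => //; exact: measurableT_comp.
have w0 q : (0 <= w q)%R by rewrite mulr_ge0.
transitivity (\int[lam2]_x \int[lam R]_y (w (x, y))%:E).
  by apply: eq_integral => x _; rewrite overlapE.
rewrite (@fubini_tonelli _ _ _ _ R lam2 (lam R) (fun q => (w q)%:E)); last 2 first.
- exact/measurable_EFinP.
- by move=> q; rewrite lee_fin.
rewrite -(integral_probability_cst (lam R)).
have mUy y : measurable_fun setT (fun x => entry_cdf W z (x, y)).
  exact: (measurableT_comp (mUz z) (pair2_measurable y)).
apply: ge0_ae_eq_integral => //.
- apply: (measurable_fun_fubini_tonelli_G (m1 := lam2) (fun q => (w q)%:E)).
    exact/measurable_EFinP.
  by move=> q; rewrite lee_fin.
- by move=> y _; apply: integral_ge0 => x _; rewrite lee_fin.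
- by move=> y _; rewrite lee_fin sqr_ge0.
move: (col_mean z); apply: filterS => y yz _.
rewrite (@integral_prod_mul _ _ _ _ R (lam R) (lam R)
  (fun x => entry_cdf W z (x, y)) (fun x => entry_cdf W z (x, y)))//.
by rewrite yz -EFinM expr2.
Qed.

Hypothesis four_cycle_le :
  \int[lam R]_z \int[lam R \x lam R]_x (overlap W z x ^+ 2)%:E <=
  \int[lam R]_z ((valI z) ^+ 4)%:E.

Lemma overlap_ae : {ae lam R, forall z,
  {ae lam R \x lam R, forall x, overlap W z x = (valI z ^+ 2)%R}}.
Proof.
pose V (z : Omega) := \int[lam2]_x ((overlap W z x - valI z ^+ 2) ^+ 2)%:E.
have V0 z : 0 <= V z by apply: integral_ge0 => x _; rewrite lee_fin sqr_ge0.
have mz : measurable_fun setT (fun q : Omega * (Omega * Omega) => valI q.1).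
  by apply: measurableT_comp => //; exact: measurable_valI.
have mV : measurable_fun setT V.
  apply: (measurable_fun_fubini_tonelli_F (m2 := lam2)
    (fun q : Omega * (Omega * Omega) => ((overlap W q.1 q.2 - valI q.1 ^+ 2) ^+ 2)%:E)).
    apply/measurable_EFinP; apply: measurable_funX; apply: measurable_funB.
      exact: measurable_overlap.
    exact: measurable_funX.
  by move=> q; rewrite lee_fin sqr_ge0.
have mz4 : measurable_fun setT (fun z : Omega => ((valI z) ^+ 4)%:E : \bar R).
  by apply/measurable_EFinP; apply: measurable_funX; exact: measurable_valI.
have z4 (z : Omega) : 0 <= ((valI z) ^+ 4)%:E :> \bar R by rewrite lee_fin exprn_ge0.
have VE z : \int[lam2]_x (overlap W z x ^+ 2)%:E = V z + ((valI z) ^+ 4)%:E.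
  rewrite (@integral_sqr_sub_mean _ _ R lam2 (overlap W z) (valI z ^+ 2))//.
  - by rewrite -exprM.
  - by move=> x; exact: overlap01.
  - exact: exprn_ge0.
  - exact: integral_overlap.
(* The mean square of the codegree is [V z + z ^ 4], so [four_cycle_le] bounds the integral of the
   nonnegative [V] by 0, the integral of [z ^ 4] being finite. *)
have IV0 : \int[lam R]_z V z = 0.
  apply/eqP; rewrite eq_le integral_ge0// andbT.
  move: four_cycle_le; rewrite (eq_integral (fun z => V z + ((valI z) ^+ 4)%:E));
    last first.
    by move=> z _; exact: VE.
  rewrite ge0_integralD// -leeBrDr ?subee//.
    apply: (@integral_probability_fin_num _ _ _ _ _ 1) => // z.
    by rewrite lee_fin exprn_ile1//; have /andP[] := valI01 z.
  apply: (@integral_probability_fin_num _ _ _ _ _ 1) => // z.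
  by rewrite lee_fin exprn_ile1//; have /andP[] := valI01 z.
have := ge0_integral0_ae mV V0 IV0; apply: filterS => z Vz.
exact: integral_sqr_sub0_ae (moz z) Vz.
Qed.

Lemma entry_cdf_ae : {ae lam R, forall z,
  {ae lam R \x lam R, forall p, entry_cdf W z p = valI z}}.
Proof.
move: overlap_ae; apply: filterS => z oz.
apply: (@codegree_const_ae _ _ _ _ R (lam R) (lam R)) => //.
- by move=> p; exact: entry_cdf01.
- move: oz; apply: filterS => x xz; by rewrite -overlapE// xz.
Qed.

(** The null set of [p] given by [entry_cdf_ae] depends on [z]. Integrating the distance [D] over
    both variables exchanges the order: for almost every [p], the distribution function of [W p] is
    right at almost every [z], which [probability_lam_unique] turns into equality of measures. *)
Lemma entries_uniform_ae : {ae lam R \x lam R, forall p, forall S,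
  measurable S -> W p S = lam R S}.
Proof.
pose D (q : Omega * (Omega * Omega)) := `|entry_cdf W q.1 q.2 - valI q.1|%R.
have mD : measurable_fun setT (fun q => (D q)%:E : \bar R).
  apply/measurable_EFinP; apply: measurableT_comp => //; apply: measurable_funB.
    exact: measurable_entry_cdf.
  by apply: measurableT_comp => //; exact: measurable_valI.
have D0 q : 0 <= (D q)%:E by rewrite lee_fin normr_ge0.
have ID0 : \int[lam2]_p \int[lam R]_z (D (z, p))%:E = 0.
  rewrite -(@fubini_tonelli _ _ _ _ R (lam R) lam2 (fun q => (D q)%:E))//.
  transitivity (\int[lam R]_z cst 0 z); last exact: integral0.
  apply: ge0_ae_eq_integral => //.
  - exact: (measurable_fun_fubini_tonelli_F (m2 := lam2) (fun q => (D q)%:E)).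
  - by move=> z _; exact: integral_ge0.
  move: entry_cdf_ae; apply: filterS => z Uz _.
  transitivity (\int[lam2]_p cst 0 p); last exact: integral0.
  apply: ge0_ae_eq_integral => //.
    exact: (measurableT_comp mD (pair1_measurable z)).
  by move: Uz; apply: filterS => p pz _; rewrite /D /= pz subrr normr0.
have mDp : measurable_fun setT (fun p => \int[lam R]_z (D (z, p))%:E).
  exact: (measurable_fun_fubini_tonelli_G (m1 := lam R) (fun q => (D q)%:E)).
have /(ge0_integral0_ae mDp) : forall p, 0 <= \int[lam R]_z (D (z, p))%:E.
  by move=> p; exact: integral_ge0.
move=> /(_ lam2 ID0); apply: filterS => p Dp.
have mDzp : measurable_fun setT (fun z => (D (z, p))%:E : \bar R).
  exact: (measurableT_comp mD (pair2_measurable p)).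
apply: probability_lam_unique.
have := @ge0_integral0_ae _ _ R (lam R) _ mDzp (fun z => D0 (z, p)) Dp;
  apply: filterS => z [] /eqP.
by rewrite normr_eq0 subr_eq0 => /eqP pz; rewrite -entry_cdfE pz.
Qed.

End uniformity.

Section main.
Local Open Scope ereal_scope.

Lemma four_cycle_le_of_patterns (R : realType)
    (W : unitI R * unitI R -> probability (unitI R) R) (f : unitI R -> unitI R) :
  is_kernel W -> measure_preserving f ->
  {ae lam R, forall x, forall S, measurable S -> \int[lam R]_y W (x, y) S = lam R S} ->
  (forall A : 'M[nat]_(2, 3), pattern A -> density W f A = (720%:R^-1)%:E) ->
  \int[lam R]_z \int[lam R \x lam R]_x (overlap W z x ^+ 2)%:E <=
  \int[lam R]_z ((valI z) ^+ 4)%:E.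
Proof.
move=> kW fmp row h23.
rewrite -(integral_dominated_event kW row) -lam_dominated_event.
(* If [s] sorts the samples, its inverse gives their ranks, so [P s] says that sample 0 outranks
   samples 1 to 4. *)
pose P (s : 'S_6) := [forall i : 'I_5,
  (i < 4)%N ==> (s^-1%g (lift ord0 i) < s^-1%g ord0)%N].
apply: (@sorted_event_le R _ _ (points_law R 2 3) 6 (entries_law W positions) _ _ _ P).
- exact: is_kernel_entries_law.
- move=> s.
  rewrite (_ : ((6`!%:R)^-1)%:E = (720%:R^-1)%:E :> \bar R)//.
  (* That the entries numbered by [positions] are sorted by [s] means that they increase along the
     numbering [positions \o s]. *)
  rewrite -(density_average kW fmp.1 (fun a => measure_preserving_atomless a fmp) h23
    (e := positions \o s)); last first.
    by apply: bij_comp; [exact: positions_bij|exact: injF_bij perm_inj].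
  apply: eq_integral => p _.
  by rewrite /entries_law prodP_reindex//; [exact: perm_inj|exact:
    measurable_sorted_tuples].
- exact: measurable_dominated_event.
- move=> s u us.
  have lts i j : (valI (tnth u i) < valI (tnth u j))%R = (s^-1%g i < s^-1%g j)%N.
    by rewrite -(reindex_sorted_tuples_lt _ _ us) !permKV.
  split=> [uD|/forallP Ps i i4]; last by rewrite lts; exact: (implyP (Ps i)).
  by apply/forallP => i; apply/implyP => i4; rewrite -lts; exact: uD.
Qed.

End main.

Theorem theorem2 (R : realType)
    (W : unitI R * unitI R -> probability (unitI R) R)
    (f : unitI R -> unitI R) (hWf : latinon W f)
    (h23 : forall A : 'M[nat]_(2, 3), pattern A ->
       density W f A = (720%:R^-1)%:E) :
  quasirandom W f.
Proof.
have [mW fmp regular] := hWf.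
have kW : is_kernel W by exact: weakP_kernel.
have row : {ae lam R, forall x, forall S, measurable S ->
    (\int[lam R]_y W (x, y) S = lam R S)%E}.
  by move: regular; apply: filterS => x xreg S /xreg[].
have col : {ae lam R, forall y, forall S, measurable S ->
    (\int[lam R]_x W (x, y) S = lam R S)%E}.
  by move: regular; apply: filterS => x xreg S /xreg[].
have key := four_cycle_le_of_patterns kW fmp row h23.
move=> k l A; apply: (density_uniform kW fmp.1).
  by move=> a; exact: measure_preserving_atomless.
exact: (entries_uniform_ae kW row col key).
Qed.
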